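(* Let $G$ be a simply connected five dimensional nilpotent Lie group with a left invariant Riemannian metric $\tilde a$, whose Lie algebra $\mathfrak l_{5,6}$ has an $\tilde a$-orthonormal basis $\{E_1,\dots,E_5\}$ with non-zero brackets $[E_1,E_2]=aE_3+bE_4+cE_5$, $[E_1,E_3]=dE_4+fE_5$, $[E_1,E_4]=gE_5$, $[E_2,E_3]=hE_5$, where $a,d,g,h>0$ and either $b>0$, or $b=0$ and $f\ge0$. If $F$ is any left invariant non-Riemannian $(\alpha,\beta)$-metric of Douglas type on $G$ defined by $\tilde a$ and a left invariant vector field $X$, then $F$ must be a Randers metric.
   Context: Brackets of basis elements not listed (and not obtained by antisymmetry) are zero. An $(\alpha,\beta)$-metric is a Finsler metric $F=\alpha\,\phi(\beta/\alpha)$, where $\alpha(x,y)=\sqrt{\tilde a(y,y)}$ is the norm of a Riemannian metric $\tilde a$, $\beta$ is a 1-form, and $\phi:(-b_0,b_0)\to\mathbb R^+$ is a $C^\infty$ function with $\phi(s)-s\phi'(s)+(b^2-s^2)\phi''(s)>0$ for $|s|\le b<b_0$, and $\|\beta_x\|_\alpha<b_0$ for all $x$. It is defined by $\tilde a$ and a vector field $X$ if $\beta(x,y)=\tilde a(y,X(x))$; here $\tilde a$ and $X$ are left invariant. A Randers metric is a Finsler metric of the form $\alpha+\beta$ (the case $\phi(s)=1+s$, $b_0=1$), with $\alpha$ the norm of a Riemannian metric and $\beta$ a 1-form of $\alpha$-norm less than one. The spray coefficients of $F$ in standard local coordinates $(x,y)$ of the tangent bundle are $G^i=\frac14 g^{il}\big([F^2]_{x^my^l}y^m-[F^2]_{x^l}\big)$,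 where $g_{ij}=\frac12\frac{\partial^2F^2}{\partial y^i\partial y^j}$. $F$ is of Douglas type if in every standard local coordinate system $G^i=\frac12\Gamma^i_{jk}(x)y^jy^k+P(x,y)y^i$ for some functions $\Gamma^i_{jk}(x)$ and some local function $P(x,y)$ positively homogeneous of degree one in $y$. *)

(* Defs.v *)
From HB Require Import structures.
From mathcomp Require Import all_boot all_order all_algebra.
From mathcomp Require Import all_classical all_reals all_analysis.
Set Implicit Arguments.
Unset Strict Implicit.
Unset Printing Implicit Defensive.
Import Order.TTheory GRing.Theory Num.Theory.
Import numFieldNormedType.Exports.
Local Open Scope classical_set_scope.
Local Open Scope ring_scope.

(** * Smooth maps between normed spaces *)

(* For open U this is the usual class C^k: f is C^(k+1) iff f is differentiable
   on U and all its directional derivatives are C^k on U. *)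
Fixpoint Ck_on (R : realType) (V W : normedModType R) (k : nat)
    (f : V -> W) (U : set V) : Prop :=
  if k is k'.+1 then
    (forall x, U x -> differentiable f x) /\
    (forall v, Ck_on k' (fun x => 'D_v f x) U)
  else forall x, U x -> {for x, continuous f}.

Definition smooth_on (R : realType) (V W : normedModType R)
  (f : V -> W) (U : set V) : Prop := forall k, Ck_on k f U.

Definition smooth_at (R : realType) (V W : normedModType R)
  (f : V -> W) (x : V) : Prop := exists2 U, open_nbhs x U & smooth_on f U.

(** * Manifolds and Lie groups *)

(* A homeomorphism from an open set of M onto an open set of R^n; the values of
   cfun outside cdom and of cinv outside cimg are irrelevant. *)
Record chart (R : realType) (n : nat) (M : topologicalType) := Chart {
  cdom : set M;
  cimg : set 'rV[R]_n;
  cfun :> M -> 'rV[R]_n;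
  cinv : 'rV[R]_n -> M;
  cdom_open : open cdom;
  cimg_open : open cimg;
  cfun_img : forall p, cdom p -> cimg (cfun p);
  cinv_dom : forall x, cimg x -> cdom (cinv x);
  cfunK : forall p, cdom p -> cinv (cfun p) = p;
  cinvK : forall x, cimg x -> cfun (cinv x) = x;
  cfun_continuous : forall p, cdom p -> {for p, continuous cfun};
  cinv_continuous : forall x, cimg x -> {for x, continuous cinv} }.

Definition smooth_transition (R : realType) n (M : topologicalType)
    (c c' : chart R n M) : Prop :=
  smooth_on (fun x => c' (cinv c x)) [set x | cimg c x /\ cdom c' (cinv c x)].

HB.mixin Record isManifold (R : realType) (n : nat) M of Topological M := {
  atlas : set (chart R n M);
  atlas_cover : forall p : M, exists2 c, atlas c & cdom c p;
  atlas_compatible :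
    forall c c', atlas c -> atlas c' -> smooth_transition c c';
  manifold_hausdorff : hausdorff_space M;
  manifold_second_countable : @second_countable M }.

#[short(type="manifoldType")]
HB.structure Definition Manifold (R : realType) (n : nat) :=
  {M of isManifold R n M & Topological M}.

HB.mixin Record isLieGroup (R : realType) (n : nat) G
    of Manifold R n G & Group G := {
  lie_mul_continuous : continuous (fun z : G * G => (z.1 * z.2)%g);
  lie_inv_continuous : continuous (fun p : G => (p^-1)%g);
  lie_mul_smooth : forall (c1 c2 c3 : chart R n G) (p q : G),
    atlas c1 -> atlas c2 -> atlas c3 ->
    cdom c1 p -> cdom c2 q -> cdom c3 (p * q)%g ->
    smooth_at (fun z : 'rV[R]_n * 'rV[R]_n =>
      c3 (cinv c1 z.1 * cinv c2 z.2)%g) (c1 p, c2 q);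
  lie_inv_smooth : forall (c1 c2 : chart R n G) (p : G),
    atlas c1 -> atlas c2 -> cdom c1 p -> cdom c2 (p^-1)%g ->
    smooth_at (fun x : 'rV[R]_n => c2 ((cinv c1 x)^-1)%g) (c1 p) }.

#[short(type="lieGroupType")]
HB.structure Definition LieGroup (R : realType) (n : nat) :=
  {G of isLieGroup R n G & Manifold R n G & Group G}.

Definition path_connected (R : realType) (M : topologicalType) : Prop :=
  forall p q : M, exists gamma : R -> M,
    [/\ {within `[0, 1], continuous gamma}, gamma 0 = p & gamma 1 = q].

Definition simply_connected (R : realType) (M : topologicalType) : Prop :=
  path_connected R M /\
  forall gamma : R -> M,
    {within `[0, 1], continuous gamma} -> gamma 0 = gamma 1 ->
    exists H : R * R -> M,
      [/\ {within (`[0, 1] `*` `[0, 1]), continuous H},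
          forall t : R, t \in `[0, 1] -> H (t, 0) = gamma t,
          forall t : R, t \in `[0, 1] -> H (t, 1) = gamma 0 &
          forall s : R, s \in `[0, 1] -> H (0, s) = gamma 0 /\ H (1, s) = gamma 0].

Definition is_subgroup (G : groupType) (A : set G) : Prop :=
  A 1%g /\ forall p q, A p -> A q -> A (p * q^-1)%g.

Fixpoint lower_central (G : groupType) (k : nat) : set G :=
  if k is k'.+1 then
    smallest (@is_subgroup G)
      [set x | exists p q, lower_central k' p /\ x = commg p q]
  else setT.

Definition nilpotent_group (G : groupType) : Prop :=
  exists k, lower_central k = [set 1%g : G].

(** * Tangent vectors, as derivations of germs of smooth functions *)

(* The charts of the maximal atlas. *)
Definition coord_chart (R : realType) n (M : manifoldType R n)
    (c : chart R n M) : Prop :=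
  forall c', atlas c' -> smooth_transition c c' /\ smooth_transition c' c.

Definition smooth_near (R : realType) n (M : manifoldType R n)
    (f : M -> R) (p : M) : Prop :=
  exists c : chart R n M, [/\ coord_chart c, cdom c p &
    smooth_at (fun x => f (cinv c x)) (c p)].

(* A tangent vector at p acts on all functions M -> R; by convention it
   vanishes on those that are not smooth near p, so that two tangent vectors
   are equal as soon as they agree on germs of smooth functions. *)
Definition tvec (R : realType) (M : Type) : Type := (M -> R) -> R.

Definition on_germs (R : realType) n (M : manifoldType R n) (p : M)
    (v : tvec R M) : tvec R M :=
  fun f => if `[< smooth_near f p >] then v f else 0.

(* \sum_i y^i d/dx^i at the point of coordinates x. *)
Definition coord_vec (R : realType) n (M : manifoldType R n)
    (c : chart R n M) (x y : 'rV[R]_n) : tvec R M :=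
  on_germs (cinv c x) (fun f => 'D_y (fun x' => f (cinv c x')) x).

Definition tangent (R : realType) n (M : manifoldType R n) (p : M)
    : set (tvec R M) :=
  [set v | exists c : chart R n M, [/\ coord_chart c, cdom c p &
    exists y, v = coord_vec c (c p) y]].

(** * Tensor fields *)

Definition vfield (R : realType) (M : Type) : Type := M -> tvec R M.

Definition is_vfield (R : realType) n (M : manifoldType R n)
    (X : vfield R M) : Prop :=
  forall c : chart R n M, coord_chart c ->
    exists2 xi : 'rV[R]_n -> 'rV[R]_n, smooth_on xi (cimg c) &
      forall x, cimg c x -> X (cinv c x) = coord_vec c x (xi x).

Definition lie_bracket (R : realType) n (M : manifoldType R n)
    (X Y : vfield R M) : vfield R M :=
  fun p => on_germs p
    (fun f => X p (fun q => Y q f) - Y p (fun q => X q f)).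

Definition is_one_form (R : realType) n (M : manifoldType R n)
    (beta : M -> tvec R M -> R) : Prop :=
  (forall p (k : R) u v, tangent p u -> tangent p v ->
     beta p (k \*o u \+ v) = k * beta p u + beta p v) /\
  (forall (c : chart R n M) (y : 'rV[R]_n), coord_chart c ->
     smooth_on (fun x => beta (cinv c x) (coord_vec c x y)) (cimg c)).

Definition is_riemannian_metric (R : realType) n (M : manifoldType R n)
    (ta : M -> tvec R M -> tvec R M -> R) : Prop :=
  [/\ forall p u v, tangent p u -> tangent p v -> ta p u v = ta p v u,
      forall p (k : R) u v w, tangent p u -> tangent p v -> tangent p w ->
        ta p (k \*o u \+ v) w = k * ta p u w + ta p v w,
      forall p v, tangent p v -> v <> cst 0 -> 0 < ta p v v &
      forall (c : chart R n M) (y z : 'rV[R]_n), coord_chart c ->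
        smooth_on (fun x =>
          ta (cinv c x) (coord_vec c x y) (coord_vec c x z)) (cimg c)].

Definition riem_norm (R : realType) (M : Type)
    (ta : M -> tvec R M -> tvec R M -> R) (p : M) (v : tvec R M) : R :=
  Num.sqrt (ta p v v).

Definition one_form_norm (R : realType) n (M : manifoldType R n)
    (ta : M -> tvec R M -> tvec R M -> R) (beta : M -> tvec R M -> R)
    (p : M) : \bar R :=
  ereal_sup [set (`|beta p v|)%:E |
              v in [set v | tangent p v /\ riem_norm ta p v <= 1]].

(** * Finsler metrics *)

Section Coordinates.
Variables (R : realType) (n : nat) (M : manifoldType R n).
Variables (F : M -> tvec R M -> R) (c : chart R n M).

Definition partial_x (m : 'I_n) (L : 'rV[R]_n -> 'rV[R]_n -> R) x y : R :=
  'D_(delta_mx 0 m) (fun x' => L x' y) x.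

Definition partial_y (l : 'I_n) (L : 'rV[R]_n -> 'rV[R]_n -> R) x y : R :=
  'D_(delta_mx 0 l) (fun y' => L x y') y.

Definition coordF (x y : 'rV[R]_n) : R := F (cinv c x) (coord_vec c x y).

Definition coordF2 (x y : 'rV[R]_n) : R := coordF x y ^+ 2.

Definition fundamental_tensor (x y : 'rV[R]_n) : 'M[R]_n :=
  \matrix_(i, j) (2^-1 * partial_y i (partial_y j coordF2) x y).

Definition spray_coef (i : 'I_n) (x y : 'rV[R]_n) : R :=
  4^-1 * \sum_l invmx (fundamental_tensor x y) i l *
    (\sum_m partial_y l (partial_x m coordF2) x y * y 0 m
     - partial_x l coordF2 x y).

End Coordinates.

Definition is_finsler (R : realType) n (M : manifoldType R n)
    (F : M -> tvec R M -> R) : Prop :=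
  [/\ forall p v, tangent p v -> v <> cst 0 -> 0 < F p v,
      forall p (k : R) v, 0 < k -> tangent p v -> F p (k \*o v) = k * F p v,
      forall c : chart R n M, coord_chart c ->
        smooth_on (fun z : 'rV[R]_n * 'rV[R]_n => coordF F c z.1 z.2)
                  [set z | cimg c z.1 /\ z.2 != 0] &
      forall (c : chart R n M) (x y w : 'rV[R]_n), coord_chart c ->
        cimg c x -> y != 0 -> w != 0 ->
        0 < (w *m fundamental_tensor F c x y *m w^T) 0 0].

Definition is_riemannian (R : realType) n (M : manifoldType R n)
    (F : M -> tvec R M -> R) : Prop :=
  exists2 ta, is_riemannian_metric ta &
    forall p v, tangent p v -> F p v = riem_norm ta p v.

(* b0 may be infinite. *)
Definition regular_phi (R : realType) (b0 : \bar R) (phi : R -> R) : Prop :=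
  [/\ (0 < b0)%E,
      smooth_on phi [set s | (`|s|%:E < b0)%E],
      forall s : R, (`|s|%:E < b0)%E -> 0 < phi s &
      forall s b : R, `|s| <= b -> (b%:E < b0)%E ->
        0 < phi s - s * derive1 phi s + (b ^+ 2 - s ^+ 2) * derive1n 2 phi s].

Definition is_alpha_beta_metric (R : realType) n (M : manifoldType R n)
    (ta : M -> tvec R M -> tvec R M -> R) (beta : M -> tvec R M -> R)
    (F : M -> tvec R M -> R) : Prop :=
  [/\ is_finsler F, is_riemannian_metric ta, is_one_form beta &
      exists (b0 : \bar R) (phi : R -> R),
        [/\ regular_phi b0 phi,
            forall p, (one_form_norm ta beta p < b0)%E &
            forall p v, tangent p v ->
              F p v = riem_norm ta p v * phi (beta p v / riem_norm ta p v)]].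

Definition is_randers (R : realType) n (M : manifoldType R n)
    (F : M -> tvec R M -> R) : Prop :=
  is_finsler F /\
  exists (ta : M -> tvec R M -> tvec R M -> R) (beta : M -> tvec R M -> R),
    [/\ is_riemannian_metric ta, is_one_form beta,
        forall p, (one_form_norm ta beta p < 1)%E &
        forall p v, tangent p v -> F p v = riem_norm ta p v + beta p v].

Definition douglas_type (R : realType) n (M : manifoldType R n)
    (F : M -> tvec R M -> R) : Prop :=
  forall c : chart R n M, coord_chart c ->
    exists (Gamma : 'I_n -> 'I_n -> 'I_n -> 'rV[R]_n -> R)
           (P : 'rV[R]_n -> 'rV[R]_n -> R),
      (forall (x y : 'rV[R]_n) (k : R), cimg c x -> y != 0 -> 0 < k -> P x (k *: y) = k * P x y) /\
      (forall (x y : 'rV[R]_n) (i : 'I_n), cimg c x -> y != 0 ->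
        spray_coef F c i x y =
          2^-1 * (\sum_j \sum_k Gamma i j k x * y 0 j * y 0 k)
          + P x y * y 0 i).

(** * Left invariance *)

(* The differential of q |-> h q. *)
Definition ltrans (R : realType) n (G : lieGroupType R n) (h : G)
    (v : tvec R G) : tvec R G := fun f => v (fun q => f (h * q)%g).

Definition left_invariant_vfield (R : realType) n (G : lieGroupType R n)
    (X : vfield R G) : Prop :=
  is_vfield X /\ forall h p, X (h * p)%g = ltrans h (X p).

Definition left_invariant_metric (R : realType) n (G : lieGroupType R n)
    (ta : G -> tvec R G -> tvec R G -> R) : Prop :=
  is_riemannian_metric ta /\
  forall h p u v, tangent p u -> tangent p v ->
    ta (h * p)%g (ltrans h u) (ltrans h v) = ta p u v.

Definition left_invariant_finsler (R : realType) n (G : lieGroupType R n)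
    (F : G -> tvec R G -> R) : Prop :=
  is_finsler F /\
  forall h p v, tangent p v -> F (h * p)%g (ltrans h v) = F p v.

(* The Lie algebra of G is the space of left invariant vector fields. *)
Definition lie_algebra_basis (R : realType) n (G : lieGroupType R n)
    (E : 'I_n -> vfield R G) : Prop :=
  (forall i, left_invariant_vfield (E i)) /\
  (forall X, left_invariant_vfield X ->
    exists! k : 'rV[R]_n, forall p f, X p f = \sum_i k 0 i * E i p f).

Definition orthonormal_frame (R : realType) n (G : lieGroupType R n)
    (ta : G -> tvec R G -> tvec R G -> R) (E : 'I_n -> vfield R G) : Prop :=
  forall i j p, ta p (E i p) (E j p) = (i == j)%:R.

Definition l56_brackets (R : realType) (G : lieGroupType R 5)
    (E : 'I_5 -> vfield R G) (a b c d f g h : R) : Prop :=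
  let E1 := E (inord 0%N) in
  let E2 := E (inord 1%N) in
  let E3 := E (inord 2%N) in
  let E4 := E (inord 3%N) in
  let E5 := E (inord 4%N) in
  forall p u,
  [/\ lie_bracket E1 E2 p u = a * E3 p u + b * E4 p u + c * E5 p u,
      lie_bracket E1 E3 p u = d * E4 p u + f * E5 p u,
      lie_bracket E1 E4 p u = g * E5 p u &
      lie_bracket E2 E3 p u = h * E5 p u] /\
  [/\ lie_bracket E1 E5 p u = 0,
      lie_bracket E2 E4 p u = 0 &
      lie_bracket E2 E5 p u = 0] /\
  [/\ lie_bracket E3 E4 p u = 0,
      lie_bracket E3 E5 p u = 0 &
      lie_bracket E4 E5 p u = 0].

(* Main.v *)
Require Import Defs.
From HB Require Import structures.
From mathcomp Require Import all_boot all_order all_algebra.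
From mathcomp Require Import all_classical all_reals all_analysis.
From mathcomp Require Import ring lra.
Set Implicit Arguments.
Unset Strict Implicit.
Unset Printing Implicit Defensive.
Import Order.TTheory GRing.Theory Num.Theory.
Import numFieldNormedType.Exports.
Local Open Scope classical_set_scope.
Local Open Scope ring_scope.

(** In the orthonormal frame E_1, ..., E_5 the left invariant field X has
    constant components k, so that in the frame coordinates u of a tangent
    vector F is the same function f u = |u| phi(<k, u> / |u|) at every point.
    Writing L = f^2 in the coordinates of a chart and differentiating the
    coframe with the structure equation [coframe_structure], the spray of F at a
    point becomes an Euler-Poincare equation [spray_frame].  Substituting the
    Douglas form of the spray coefficients and removing the projective factor P
    with Euler's relations leaves [douglas_frame]: there is a quadratic map Q of
    R^n such that, for all u <> 0 and all v,

        Hess f (u) (v, Q u) = df (u) ([v, u]).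

    Test this on unit vectors u = tau k + sigma y with y orthogonal to k, so
    that s = <k, u> is a free parameter in [-|k|, |k|], against v orthogonal
    to u.  If <k, [., .]> <> 0 (the form beta is not closed), a suitable y and v
    orthogonal to k isolate one coefficient of the quadratic polynomial
    <Q u - ..., v> and give phi' = kappa s (phi - s phi') [nonclosed_case].  If
    <k, [., .]> = 0, then in l_(5,6) k is a combination of E_1 and E_2, and some
    z orthogonal to k has <z, [k, z]> <> 0; comparing powers of tau and sigma gives
    phi'' = lambda (phi - s phi' + (|k|^2 - s^2) phi'') with constant lambda
    [closed_case].  Either differential equation integrates to

        phi(s) = phi(0) sqrt(1 + m s^2) + C s      (C = 0 in the first case)

    on [-|k|, |k|] ([riemann_type_ode], [randers_type_ode]).  Hence F is the sum
    of the norm of the Riemannian metric phi(0)^2 (a + m beta^2) and of the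
    one-form C beta, whose norm is less than one because phi(|k|) and phi(-|k|)
    are positive [is_randers_of_type]. *)

(** * Calculus on the real line and two differential equations *)

Section RealAnalysis.
Variable R : realType.
Implicit Types (f g : R -> R) (s t a b k : R).

Lemma is_derive_cstf a t : is_derive t 1 (fun=> a) (0 : R).
Proof. exact: (@is_derive_cst R R R a t 1). Qed.

Lemma is_derive_idf t : is_derive t 1 (fun x : R => x) (1 : R).
Proof. exact: (@is_derive_id R R t 1). Qed.

Lemma is_derive_addf f g t a b :
  is_derive t 1 f a -> is_derive t 1 g b ->
  is_derive t 1 (fun x => f x + g x) (a + b).
Proof. exact: is_deriveD. Qed.

Lemma is_derive_subf f g t a b :
  is_derive t 1 f a -> is_derive t 1 g b ->
  is_derive t 1 (fun x => f x - g x) (a - b).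
Proof. exact: is_deriveB. Qed.

Lemma is_derive_mulf f g t a b :
  is_derive t 1 f a -> is_derive t 1 g b ->
  is_derive t 1 (fun x => f x * g x) (a * g t + f t * b).
Proof.
move=> fa gb; have H := is_deriveM fa gb.
have -> : (fun x => f x * g x) = f * g by [].
apply: is_derive_eq H _.
by rewrite /GRing.scale /= mulrC addrC [a * _]mulrC; ring.
Qed.

Lemma is_derive_divf f g t a b : g t != 0 ->
  is_derive t 1 f a -> is_derive t 1 g b ->
  is_derive t 1 (fun x => f x / g x) ((a * g t - f t * b) / g t ^+ 2).
Proof.
move=> g0 fa gb.
apply: is_derive_eq (is_derive_mulf fa (is_deriveV g0 gb)) _.
rewrite /GRing.scale /=; field; exact: g0.
Qed.

Lemma is_derive_sqrtf f t a : 0 < f t -> is_derive t 1 f a ->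
  is_derive t 1 (fun x => Num.sqrt (f x)) (a / (2 * Num.sqrt (f t))).
Proof.
move=> f0 fa; rewrite mulrC.
exact: (@is_derive1_comp _ (@Num.sqrt R) f t _ a (is_derive1_sqrt f0) fa).
Qed.

Lemma is_derive_compf f g t a b :
  is_derive (g t) 1 f a -> is_derive t 1 g b ->
  is_derive t 1 (fun x => f (g x)) (a * b).
Proof. exact: is_derive1_comp. Qed.

(** The hypothesis is on a closed interval, endpoints included, because the
    endpoints s = -|k| and s = |k| are the directions of X itself, where the
    bound on the norm of the one-form is decided. *)
Lemma cst_of_is_derive0 f b :
  (forall s, `|s| <= b -> is_derive s 1 f 0) ->
  forall s, `|s| <= b -> f s = f 0.
Proof.
move=> df s sb.
have cf : forall u v, (forall x, x \in `[u, v] -> `|x| <= b) -> u <= v -> f u = f v.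
  move=> u v uv ulev.
  have [||c _] := @MVT_segment R f (fun=> 0) u v ulev.
  - move=> x xuv; apply: df; apply: uv.
    by move: xuv; rewrite !in_itv /= => /andP[/ltW -> /ltW ->].
  - apply: derivable_within_continuous => x /uv xb.
    by have [] := df x xb.
  - by rewrite mul0r => /eqP; rewrite subr_eq0 => /eqP.
case: (lerP 0 s) => s0.
  apply/esym/cf => // x; rewrite in_itv /= => /andP[x0 xs].
  by rewrite (le_trans _ sb)// !ger0_norm.
apply: cf (ltW s0) => x; rewrite in_itv /= => /andP[x0 xs].
by rewrite (le_trans _ sb)// !ler0_norm// ?lerN2// ltW.
Qed.

(** Identities between phi and its derivatives are obtained by dividing by s
    and by a quantity vanishing at the endpoints; continuity gives them back on
    the whole closed interval. *)
Lemma zero_by_density g b : 0 < b ->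
  (forall s, `|s| <= b -> {for s, continuous g}) ->
  (forall s, `|s| < b -> s != 0 -> g s = 0) ->
  forall s, `|s| <= b -> g s = 0.
Proof.
move=> b0 cg g0 s sb; apply/eqP/negPn/negP => gs0.
have gs : 0 < `|g s| by rewrite normr_gt0.
have /cvgrPdist_lt /(_ _ gs) := cg s sb.
case/nbhs_ballP => e /= e0 Be.
have [y [ye yb y0]] : exists y, [/\ `|s - y| < e, `|y| < b & y != 0].
  have [s0|s0] := eqVneq s 0.
    exists (Num.min e b / 2); have m0 : 0 < Num.min e b by rewrite lt_min e0.
    have h0 : 0 < Num.min e b / 2 by rewrite divr_gt0.
    have h1 : Num.min e b / 2 < Num.min e b by rewrite ltr_pdivrMr// ltr_pMr// ltr1n.
    rewrite s0 sub0r normrN gtr0_norm// gt_eqF//; split => //.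
      by rewrite (lt_le_trans h1)// ge_min lexx.
    by rewrite (lt_le_trans h1)// ge_min lexx orbT.
  set d := Num.min (2^-1) (e / (2 * `|s|)).
  have ns : 0 < `|s| by rewrite normr_gt0.
  have d0 : 0 < d by rewrite lt_min invr_gt0 ltr0n /= divr_gt0// mulr_gt0.
  have d1 : d < 1 by rewrite gt_min invf_lt1 ?ltr1n// ltr0n.
  have dn : d * `|s| < e.
    have : d <= e / (2 * `|s|) by rewrite ge_min lexx orbT.
    rewrite ler_pdivlMr ?mulr_gt0// => h.
    apply: lt_le_trans h; rewrite mulrCA ltr_pMl ?ltr1n//.
    exact: mulr_gt0.
  exists ((1 - d) * s); split.
  - have -> : s - (1 - d) * s = d * s by ring.
    by rewrite normrM gtr0_norm.
  - rewrite normrM ger0_norm ?subr_ge0 ?ltW//.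
    rewrite (lt_le_trans _ sb)// gtr_pMl//; lra.
  - by rewrite mulf_neq0// subr_eq0 eq_sym lt_eqF.
by have := Be y ye; rewrite /= (g0 y)// subr0 ltxx.
Qed.

Section Ode.
Variables (p p1 p2 : R -> R) (b k : R).
Hypothesis w_gt0 : forall s, `|s| <= b -> 0 < 1 + k * s ^+ 2.
Hypothesis dp : forall s, `|s| <= b -> is_derive s 1 p (p1 s).

Let r (s : R) : R := Num.sqrt (1 + k * s ^+ 2).

Let r_gt0 s : `|s| <= b -> 0 < r s.
Proof. by move=> /w_gt0; rewrite -sqrtr_gt0. Qed.

Let r_sqr s : `|s| <= b -> r s ^+ 2 = 1 + k * s ^+ 2.
Proof. by move=> /w_gt0/ltW/sqr_sqrtr. Qed.

Let r0 : r 0 = 1.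
Proof. by rewrite /r expr0n mulr0 addr0 sqrtr1. Qed.

Let dr s : `|s| <= b -> is_derive s 1 r (k * s / r s).
Proof.
move=> sb; have := r_gt0 sb; have := w_gt0 sb => w0 rs.
have dw : is_derive s 1 (fun x : R => 1 + k * x ^+ 2) (2 * k * s).
  have -> : (fun x : R => 1 + k * x ^+ 2) = fun x => 1 + k * (x * x).
    by apply/funext => x; rewrite expr2.
  apply: is_derive_eq (is_derive_addf (is_derive_cstf 1 s) (is_derive_mulf
    (is_derive_cstf k s) (is_derive_mulf (is_derive_idf s) (is_derive_idf s)))) _.
  by ring.
apply: is_derive_eq (is_derive_sqrtf (f := fun x => 1 + k * x ^+ 2) w0 dw) _.
rewrite -/(r s); field; exact: lt0r_neq0.
Qed.

(** The derivative of p / sqrt(1 + k s^2) vanishes. *)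
Lemma riemann_type_ode :
  (forall s, `|s| <= b -> p1 s * (1 + k * s ^+ 2) = k * s * p s) ->
  forall s, `|s| <= b -> p s = p 0 * r s.
Proof.
move=> ode s sb.
suff H : forall x : R, `|x| <= b -> is_derive x 1 (fun s => p s / r s) 0.
  have := cst_of_is_derive0 H sb; rewrite r0 divr1 => <-.
  by rewrite divfK// lt0r_neq0 ?r_gt0.
move=> {s} {}s {}sb; have rs := r_gt0 sb.
have rs0 := lt0r_neq0 rs.
apply: is_derive_eq (is_derive_divf rs0 (dp sb) (dr sb)) _.
have -> : (p1 s * r s - p s * (k * s / r s)) = (p1 s * r s ^+ 2 - k * s * p s) / r s.
  by field; exact: lt0r_neq0.
by rewrite r_sqr// ode// subrr !mul0r.
Qed.

Hypothesis dp1 : forall s, `|s| <= b -> is_derive s 1 p1 (p2 s).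

(** Two first integrals: (p - s p') sqrt(1 + k s^2) is constant, and then
    p' - p(0) k s / sqrt(1 + k s^2) is constant.  Eliminating p' gives p. *)
Lemma randers_type_ode :
  (forall s, `|s| <= b -> p2 s * (1 + k * s ^+ 2) = k * (p s - s * p1 s)) ->
  forall s, `|s| <= b -> p s = p 0 * r s + p1 0 * s.
Proof.
move=> ode.
have H1 s : `|s| <= b -> (p s - s * p1 s) * r s = p 0.
  move=> sb.
  suff H (x : R) : `|x| <= b -> is_derive x 1 (fun s => (p s - s * p1 s) * r s) 0.
    by rewrite (cst_of_is_derive0 H sb) r0 mul0r subr0 mulr1.
  move=> {s} {}sb; move: x sb => s sb; have rs := r_gt0 sb.
  have du := is_derive_subf (dp sb) (is_derive_mulf (is_derive_idf s) (dp1 sb)).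
  apply: is_derive_eq (is_derive_mulf du (dr sb)) _.
  transitivity (- s * (p2 s * r s ^+ 2 - k * (p s - s * p1 s)) / r s).
    by field; exact: lt0r_neq0.
  by rewrite r_sqr// ode// subrr mulr0 mul0r.
have H2 s : `|s| <= b -> p1 s - p 0 * k * (s / r s) = p1 0.
  move=> sb.
  suff H (x : R) : `|x| <= b -> is_derive x 1 (fun s => p1 s - p 0 * k * (s / r s)) 0.
    by rewrite (cst_of_is_derive0 H sb) mul0r mulr0 subr0.
  move=> {s} {}sb; move: x sb => s sb; have rs := r_gt0 sb.
  have dq := is_derive_divf (lt0r_neq0 rs) (is_derive_idf s) (dr sb).
  apply: is_derive_eq (is_derive_subf (dp1 sb)
    (is_derive_mulf (is_derive_cstf (p 0 * k) s) dq)) _.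
  rewrite -(H1 s sb).
  transitivity ((p2 s * r s ^+ 2 - k * (p s - s * p1 s) * (r s ^+ 2 - k * s ^+ 2)) / r s ^+ 2).
    by field; exact: lt0r_neq0.
  by rewrite r_sqr// ode// addrK mulr1 subrr mul0r.
move=> s sb; have rs := r_gt0 sb.
rewrite -(H2 s sb) -(H1 s sb).
have -> : (p s - s * p1 s) * r s * r s + (p1 s - (p s - s * p1 s) * r s * k * (s / r s)) * s =
   (p s - s * p1 s) * (r s ^+ 2 - k * s ^+ 2) + s * p1 s.
  by field; exact: lt0r_neq0.
by rewrite r_sqr//; ring.
Qed.

End Ode.
End RealAnalysis.

(** * Minkowski norms of type |u| phi(<k, u> / |u|) satisfying the Douglas equation *)

Section Dot.
Variables (R : realType) (n : nat).
Implicit Types (u v w : 'rV[R]_n) (a : R).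

Definition dot u v : R := \sum_i u 0 i * v 0 i.

Lemma dotC u v : dot u v = dot v u.
Proof. by apply: eq_bigr => i _; rewrite mulrC. Qed.

Lemma dotDl u v w : dot (u + v) w = dot u w + dot v w.
Proof. by rewrite -big_split; apply: eq_bigr => i _; rewrite mxE mulrDl. Qed.

Lemma dotZl a u v : dot (a *: u) v = a * dot u v.
Proof. by rewrite mulr_sumr; apply: eq_bigr => i _; rewrite mxE mulrA. Qed.

Lemma dotDr u v w : dot u (v + w) = dot u v + dot u w.
Proof. by rewrite !(dotC u) dotDl. Qed.

Lemma dotZr a u v : dot u (a *: v) = a * dot u v.
Proof. by rewrite !(dotC u) dotZl. Qed.

Lemma dotNl u v : dot (- u) v = - dot u v.
Proof. by rewrite -scaleN1r dotZl mulN1r. Qed.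

Lemma dotNr u v : dot u (- v) = - dot u v.
Proof. by rewrite !(dotC u) dotNl. Qed.

Lemma dot0l v : dot 0 v = 0.
Proof. by rewrite -(scale0r 0) dotZl mul0r. Qed.

Lemma dot0r v : dot v 0 = 0.
Proof. by rewrite dotC dot0l. Qed.

Lemma dot_ge0 u : 0 <= dot u u.
Proof. by apply: sumr_ge0 => i _; rewrite -expr2 sqr_ge0. Qed.

Lemma dot_eq0 u : (dot u u == 0) = (u == 0).
Proof.
apply/idP/eqP => [|->]; last by rewrite dot0l.
rewrite psumr_eq0 => [/allP u0|i _]; last by rewrite -expr2 sqr_ge0.
apply/rowP => i; rewrite mxE; apply/eqP.
by have := u0 i; rewrite mem_index_enum -expr2 sqrf_eq0 => /(_ isT)/eqP ->.
Qed.

Lemma dot_gt0 u : (0 < dot u u) = (u != 0).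
Proof. by rewrite lt_neqAle dot_ge0 andbT eq_sym dot_eq0. Qed.

Definition dotE := (dotDl, dotDr, dotZl, dotZr, dotNl, dotNr, dot0l, dot0r).

Lemma linear_form_sum (l : 'rV[R]_n -> R) :
  (forall a u v, l (a *: u + v) = a * l u + l v) ->
  forall v, l v = \sum_i v 0 i * l (delta_mx 0 i).
Proof.
move=> ll v.
have l0 : l 0 = 0.
  have := ll 1 0 0; rewrite scaler0 addr0 mul1r => h.
  by apply: (addIr (l 0)); rewrite -h add0r.
rewrite {1}(row_sum_delta v).
by apply: (big_rec2 (fun x y => l x = y)) => // i y x _ <-; rewrite ll.
Qed.

Lemma linear_form_dot (l : 'rV[R]_n -> R) :
  (forall a u v, l (a *: u + v) = a * l u + l v) ->
  exists z, forall v, l v = dot z v.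
Proof.
move=> ll; exists (\row_i l (delta_mx 0 i)) => v; rewrite (linear_form_sum ll).
by apply: eq_bigr => i _; rewrite mxE mulrC.
Qed.

Lemma dot_mulmxr (u v : 'rV[R]_n) (A : 'M[R]_n) :
  dot u (v *m A) = dot (u *m A^T) v.
Proof.
have dE x y : dot x y = (x *m y^T) 0 0.
  by rewrite !mxE; apply: eq_bigr => i _; rewrite mxE.
by rewrite !dE trmx_mul mulmxA.
Qed.

Lemma exists_orthogonal u v : (2 < n)%N ->
  exists y, [/\ y != 0, dot u y = 0 & dot v y = 0].
Proof.
move=> n2; set M := row_mx u^T v^T.
have : kermx M != 0.
  rewrite -mxrank_eq0 mxrank_ker subn_eq0 -ltnNge.
  by rewrite (leq_ltn_trans (rank_leq_col M)).
case/rowV0Pn => y /sub_kermxP; rewrite mul_mx_row -[0]row_mx0 => /eq_row_mx[yu yv] y0.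
exists y; split => //.
  have := congr1 (fun A : 'M[R]_1 => A 0 0) yu; rewrite !mxE => <-.
  by apply: eq_bigr => i _; rewrite mxE mulrC.
have := congr1 (fun A : 'M[R]_1 => A 0 0) yv; rewrite !mxE => <-.
by apply: eq_bigr => i _; rewrite mxE mulrC.
Qed.

End Dot.

Section Minkowski.
Variables (R : realType) (n : nat).
Local Notation V := 'rV[R]_n.

(** All that is needed of a vector-valued quadratic form: along every
    2-plane it is a homogeneous quadratic polynomial in the coordinates. *)
Definition quadratic_on_planes (W : lmodType R) (Q : V -> W) :=
  forall u v, exists B, forall a b : R,
    Q (a *: u + b *: v) = a ^+ 2 *: Q u + (a * b) *: B + b ^+ 2 *: Q v.

Variables (k : V) (phi phi1 phi2 : R -> R).

Definition ab_arg (u : V) : R := dot k u / Num.sqrt (dot u u).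

(** First differential at u, in the direction v, of |u| phi(<k, u> / |u|). *)
Definition ab_d (u v : V) : R :=
  let s := ab_arg u in
  (phi s - s * phi1 s) * (dot u v / Num.sqrt (dot u u)) + phi1 s * dot k v.

(** Second differential at u of the same function; phi1 and phi2 stand for the
    first two derivatives of phi. *)
Definition ab_dd (u v w : V) : R :=
  let r := Num.sqrt (dot u u) in let s := ab_arg u in
  (phi s - s * phi1 s) * (dot v w / r - dot u v * dot u w / r ^+ 3)
  + phi2 s * (dot k v - s * dot u v / r) * (dot k w - s * dot u w / r) / r.

Variables (br : V -> V -> V) (Q : V -> V).
Hypothesis br_linl : forall a u v w, br (a *: u + v) w = a *: br u w + br v w.
Hypothesis br_linr : forall a u v w, br w (a *: u + v) = a *: br w u + br w v.
Hypothesis br_alt : forall u, br u u = 0.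
Hypothesis Q_quad : quadratic_on_planes Q.
Hypothesis douglas : forall u v, u != 0 -> ab_dd u v (Q u) = ab_d u (br v u).

Let u1 (s : R) : R := phi s - s * phi1 s.
Let b : R := Num.sqrt (dot k k).
Let D (s : R) : R := u1 s + (b ^+ 2 - s ^+ 2) * phi2 s.

Hypothesis k_neq0 : k != 0.
Hypothesis u1_gt0 : forall s, `|s| <= b -> 0 < u1 s.

Lemma br_skew u v : br u v = - br v u.
Proof.
have brD x y z : br (x + y) z = br x z + br y z.
  by rewrite -{1}[x]scale1r br_linl scale1r.
have brD' x y z : br z (x + y) = br z x + br z y.
  by rewrite -{1}[x]scale1r br_linr scale1r.
have := br_alt (u + v); rewrite brD !brD' !br_alt add0r addr0 => /eqP.
by rewrite addr_eq0 => /eqP.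
Qed.

Lemma br0r u : br u 0 = 0.
Proof.
have := br_linr 1 0 0 u; rewrite !scale1r addr0 => h.
by apply: (addIr (br u 0)); rewrite -h add0r.
Qed.

Lemma brZr a u v : br u (a *: v) = a *: br u v.
Proof. by rewrite -[a *: v]addr0 br_linr br0r addr0. Qed.

Lemma brZl a u v : br (a *: u) v = a *: br u v.
Proof. by rewrite br_skew brZr br_skew scalerN opprK. Qed.

(** T u v = 0 for all v orthogonal to u would say that Q is, up to a multiple
    of u, the spray of the Euclidean norm: T measures the deviation from it. *)
Let T (u v : V) : R := dot (Q u) v - dot u (br v u).

Let b_gt0 : 0 < b.
Proof. by rewrite sqrtr_gt0 dot_gt0. Qed.

Let b_sqr : b ^+ 2 = dot k k.
Proof. by rewrite sqr_sqrtr// dot_ge0. Qed.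

Let T_quad v x y : exists B, forall a c : R,
  T (a *: x + c *: y) v = a ^+ 2 * T x v + a * c * B + c ^+ 2 * T y v.
Proof.
have [B HB] := Q_quad x y.
exists (dot B v - dot x (br v y) - dot y (br v x)) => a c.
rewrite /T HB br_linr brZr !dotE; ring.
Qed.

Let T_lin u a v c w : T u (a *: v + c *: w) = a * T u v + c * T u w.
Proof. by rewrite /T br_linl brZl !dotE; ring. Qed.

Let unit_eq u v : dot u u = 1 -> dot u v = 0 ->
  u1 (dot k u) * T u v
  + phi2 (dot k u) * dot k v * (dot k (Q u) - dot k u * dot u (Q u))
  = phi1 (dot k u) * dot k (br v u).
Proof.
move=> uu uv; have u0 : u != 0 by rewrite -dot_gt0 uu.
have := douglas v u0; rewrite /ab_dd /ab_d /ab_arg uu sqrtr1 uv !divr1.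
rewrite -/(u1 _) mulr0 !mul0r !subr0 => e.
rewrite /T mulrBr (dotC (Q u)); apply: (addIr (u1 (dot k u) * dot u (br v u))).
by rewrite [RHS]addrC -e; ring.
Qed.

(** Unit vectors of the plane spanned by k and y with prescribed product s
    with k; the sign e gives the two mirror images in the line of k. *)
Let circle s y : dot k y = 0 -> y != 0 -> `|s| <= b ->
  exists2 c : R, c ^+ 2 * (b ^+ 2 * dot y y) = b ^+ 2 - s ^+ 2 &
   [/\ (0 <= c), (`|s| < b -> 0 < c) ,
    c = Num.sqrt (b ^+ 2 - s ^+ 2) / Num.sqrt (b ^+ 2 * dot y y) &
   forall e, e ^+ 2 = 1 ->
   let u := (s / b ^+ 2) *: k + (e * c) *: y in
   dot u u = 1 /\ dot k u = s].
Proof.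
move=> ky y0 sb.
have b2 : 0 < b ^+ 2 by rewrite exprn_gt0.
have yy : 0 < dot y y by rewrite dot_gt0.
have sb2 : 0 <= b ^+ 2 - s ^+ 2.
  by rewrite subr_ge0 -[s ^+ 2]real_normK ?num_real// ler_sqr// nnegrE// ltW.
have P : 0 < b ^+ 2 * dot y y by rewrite mulr_gt0.
set c := Num.sqrt (b ^+ 2 - s ^+ 2) / Num.sqrt (b ^+ 2 * dot y y).
have cE : c ^+ 2 * (b ^+ 2 * dot y y) = b ^+ 2 - s ^+ 2.
  by rewrite /c expr_div_n (sqr_sqrtr sb2) (sqr_sqrtr (ltW P)) divfK// gt_eqF.
exists c => //; split => //.
- by rewrite divr_ge0 ?sqrtr_ge0.
- move=> sb'; rewrite divr_gt0 ?sqrtr_gt0//.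
  rewrite subr_gt0 -[s ^+ 2]real_normK ?num_real// ltr_sqr ?nnegrE//.
  exact: ltW.
move=> e e2 /=; rewrite !dotE ky (dotC y) ky -b_sqr; split; last first.
  by field; exact: lt0r_neq0.
apply: (mulfI (lt0r_neq0 b2)); rewrite mulr1.
transitivity (s ^+ 2 + e ^+ 2 * (c ^+ 2 * (b ^+ 2 * dot y y))).
  by field; exact: lt0r_neq0.
by rewrite cE e2; ring.
Qed.

(** Let S be the skew operator with <S y, w> = <k, [w, y]>.  For w orthogonal
    to k and to u the Hessian term in phi'' disappears, and the Douglas equation
    reads (phi - s phi') T u w = phi' <S u, w>.  Taking the two mirror images
    u = tau k +- sigma y and adding (if S k <> 0, with w = S k) or subtracting
    (if S k = 0, with w = S y), one keeps a single monomial on the left and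
    a single term on the right. *)
Lemma nonclosed_case : (2 < n)%N -> (exists w y, dot k (br w y) != 0) ->
  exists kappa, forall s, `|s| < b -> s != 0 -> phi1 s = kappa * s * u1 s.
Proof.
move=> n2 [w0 [y0 wy0]].
have b2 : 0 < b ^+ 2 by rewrite exprn_gt0.
have [S HS] : exists S : V -> V, forall y w, dot k (br w y) = dot (S y) w.
  suff /choice [S HS] : forall y, exists z, forall w, dot k (br w y) = dot z w.
    by exists S.
  by move=> y; apply: linear_form_dot => a u v; rewrite br_linl !dotE.
have Slin a u v : forall w, dot (S (a *: u + v)) w = a * dot (S u) w + dot (S v) w.
  by move=> w; rewrite -!HS br_linr !dotE.
have SZ a u : forall w, dot (S (a *: u)) w = a * dot (S u) w.
  by move=> w; rewrite -!HS brZr !dotE.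
have Salt u : dot (S u) u = 0 by rewrite -HS br_alt dot0r.
have Sskew u v : dot (S u) v = - dot (S v) u by rewrite -!HS br_skew dotNr.
have b_norm s : `|s| < b -> `|s| <= b by exact: ltW.
have key w y s : dot w k = 0 -> dot w y = 0 -> dot k y = 0 -> y != 0 -> `|s| < b ->
  exists2 c, 0 < c & forall e, e ^+ 2 = 1 ->
   u1 s * T ((s / b ^+ 2) *: k + (e * c) *: y) w =
   phi1 s * ((s / b ^+ 2) * dot (S k) w + e * c * dot (S y) w).
  move=> wk wy ky yn sb.
  have [c _ [_ c0 _ Hc]] := circle ky yn (ltW sb).
  exists c; first exact: c0.
  move=> e e2; have [uu ku] := Hc e e2.
  have uw : dot ((s / b ^+ 2) *: k + (e * c) *: y) w = 0.
    by rewrite !dotE (dotC k) wk (dotC y) wy !mulr0 addr0.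
  have := unit_eq uu uw; rewrite ku (dotC k w) wk mulr0 mul0r addr0 => ->.
  by rewrite HS Slin SZ.
have e1 : 1 ^+ 2 = 1 :> R by rewrite expr1n.
have eN1 : (-1) ^+ 2 = 1 :> R by rewrite sqrrN expr1n.
have [Sk0|Sk0] := eqVneq (S k) 0.
  (* S k = 0: removing from y0 its component along k does not change S y0. *)
  pose y := y0 - (dot k y0 / b ^+ 2) *: k.
  have Sy w : dot (S y) w = dot (S y0) w.
    by rewrite /y addrC -scaleNr Slin Sk0 dot0l mulr0 add0r.
  have ky : dot k y = 0.
    rewrite /y !dotE -b_sqr; field; exact: lt0r_neq0.
  have Sy0 : S y != 0.
    by apply: contraNneq wy0 => Sy0; rewrite HS -Sy Sy0 dot0l.
  have y_neq0 : y != 0.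
    apply: contraNneq Sy0 => y00; rewrite -dot_eq0 {1}y00 -[0](scale0r 0) SZ.
    by rewrite mul0r.
  have ww : 0 < dot (S y) (S y) by rewrite dot_gt0.
  have [B HB] := T_quad (S y) k y.
  exists (B / (dot (S y) (S y) * b ^+ 2)) => s sb _.
  have wk : dot (S y) k = 0 by rewrite Sskew Sk0 dot0l oppr0.
  have [c c0 Hc] := key (S y) y s wk (Salt y) ky y_neq0 sb.
  have := Hc 1 e1; have := Hc (-1) eN1.
  rewrite !HB Sk0 dot0l mulr0 !add0r => E1 E2.
  apply: (mulIf (lt0r_neq0 ww)); apply: (mulIf (lt0r_neq0 c0)).
  apply: (@mulfI _ 2); first by rewrite pnatr_eq0.
  set W := dot (S y) (S y) in E1 E2 ww *.
  transitivity (u1 s * (2 * (s / b ^+ 2) * c * B)).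
    transitivity (phi1 s * (1 * c * W) - phi1 s * (-1 * c * W)); first by ring.
    by rewrite -E1 -E2; ring.
  field; apply/andP; split; exact: lt0r_neq0.
have [y [y_neq0 ky wy]] := exists_orthogonal k (S k) n2.
have ww : 0 < dot (S k) (S k) by rewrite dot_gt0.
set W := dot (S k) (S k) in ww.
have [B HB] := T_quad (S k) k y.
have sum s : `|s| < b -> exists2 c, 0 < c &
   u1 s * ((s / b ^+ 2) ^+ 2 * T k (S k) + c ^+ 2 * T y (S k)) = phi1 s * (s / b ^+ 2 * W).
  move=> sb; have [c c0 Hc] := key (S k) y s (Salt k) wy ky y_neq0 sb.
  exists c => //.
  have := Hc 1 e1; have := Hc (-1) eN1; rewrite !HB => E1 E2.
  apply: (@mulfI _ 2); first by rewrite pnatr_eq0.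
  rewrite -/W in E1 E2.
  transitivity (phi1 s * (s / b ^+ 2 * W + 1 * c * dot (S y) (S k)) +
    phi1 s * (s / b ^+ 2 * W + -1 * c * dot (S y) (S k))); last by ring.
  by rewrite -E1 -E2; ring.
(* At s = 0 the coefficient tau vanishes but sigma does not. *)
have C0 : T y (S k) = 0.
  have [|c c0] := sum 0; first by rewrite normr0.
  rewrite !mul0r expr0n mul0r add0r mulr0 => /eqP.
  rewrite mulf_eq0 gt_eqF ?u1_gt0 ?normr0 ?(ltW b_gt0)//= mulf_eq0.
  by rewrite expf_eq0 /= gt_eqF//= => /eqP.
exists (T k (S k) / (W * b ^+ 2)) => s sb s0.
have [c c0] := sum s sb; rewrite C0 mulr0 addr0 => E.
apply: (mulIf (lt0r_neq0 ww)).
have t0 : s / b ^+ 2 != 0 by rewrite mulf_neq0// invr_neq0// lt0r_neq0.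
apply: (mulfI t0).
transitivity (phi1 s * (s / b ^+ 2 * W)); first by ring.
rewrite -E; field; apply/andP; split; exact: lt0r_neq0.
Qed.

Hypothesis D_gt0 : forall s, `|s| <= b -> 0 < D s.
Hypothesis dphi : forall s : R, `|s| <= b -> is_derive s 1 phi (phi1 s).
Hypothesis dphi1 : forall s : R, `|s| <= b -> is_derive s 1 phi1 (phi2 s).
Hypothesis phi2_cont : forall s : R, `|s| <= b -> {for s, continuous phi2}.

Let phi_cont (s : R) : `|s| <= b -> {for s, continuous phi}.
Proof.
move=> /dphi [ds _]; apply: differentiable_continuous.
exact/derivable1_diffP.
Qed.

Let phi1_cont (s : R) : `|s| <= b -> {for s, continuous phi1}.
Proof.
move=> /dphi1 [ds _]; apply: differentiable_continuous.
exact/derivable1_diffP.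
Qed.

Let u1_cont (s : R) : `|s| <= b -> {for s, continuous u1}.
Proof.
move=> sb; apply: cvgB; first exact: phi_cont.
by apply: cvgM; [exact: cvg_id|exact: phi1_cont].
Qed.

Let D_cont (s : R) : `|s| <= b -> {for s, continuous D}.
Proof.
move=> sb; apply: cvgD; first exact: u1_cont.
apply: cvgM; last exact: phi2_cont.
apply: cvgB; first exact: cvg_cst.
by apply: cvgM; exact: cvg_id.
Qed.

(** With <k, [., .]> = 0, testing the Douglas equation on the part of k
    orthogonal to u and eliminating gives, for v orthogonal to u,
    T u v = - (phi'' / D) <k, v> <u, [k, u]>.  For u = tau k + sigma z and
    v = sigma |z|^2 k - tau |k|^2 z the left side is a cubic form in
    (tau, sigma) and the right side is a multiple of sigma^3; letting
    sigma tend to 0 (that is, s to |k|) kills the other three coefficients one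
    after the other, so that phi'' / D is constant. *)
Lemma closed_case z : (forall w y, dot k (br w y) = 0) ->
  dot k z = 0 -> dot z (br k z) != 0 ->
  exists lambda, forall s, `|s| <= b -> phi2 s = lambda * D s.
Proof.
move=> S0 kz r0.
have z0 : z != 0 by apply: contraNneq r0 => ->; rewrite dot0l.
have zz : 0 < dot z z by rewrite dot_gt0.
have b2 : 0 < b ^+ 2 by rewrite exprn_gt0.
set r := dot z (br k z) in r0.
have [B1 HB1] := T_quad k k z; have [B2 HB2] := T_quad z k z.
pose L (s : R) : R := phi2 s / D s.
have L_cont (s : R) : `|s| <= b -> {for s, continuous L}.
  move=> sb; apply: cvgM; first exact: phi2_cont.
  by apply: cvgV; [exact/lt0r_neq0/D_gt0|exact: D_cont].
pose t (s : R) : R := s / b ^+ 2.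
pose c (s : R) : R := Num.sqrt (b ^+ 2 - s ^+ 2) / Num.sqrt (b ^+ 2 * dot z z).
have t_cont (s : R) : {for s, continuous t}.
  by apply: cvgM; [exact: cvg_id|exact: cvg_cst].
have c_cont (s : R) : {for s, continuous c}.
  have h : {for s, continuous (fun s : R => b ^+ 2 - s ^+ 2)}.
    apply: cvgB; first exact: cvg_cst.
    by apply: cvgM; exact: cvg_id.
  apply: cvgM; last exact: cvg_cst.
  exact: (continuous_comp h (@sqrt_continuous R _)).
have c_gt0 s : `|s| < b -> 0 < c s.
  move=> sb; have [x _ [_ /(_ sb) x0 xE _]] := circle kz z0 (ltW sb).
  by rewrite /c -xE.
have cb : c b = 0 by rewrite /c subrr sqrtr0 mul0r.
have bb : `|b| <= b by rewrite ger0_norm// ltW.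
have main s : `|s| <= b ->
  c s * dot z z * (t s ^+ 2 * T k k + t s * c s * B1 + c s ^+ 2 * T z k)
  - t s * b ^+ 2 * (t s ^+ 2 * T k z + t s * c s * B2 + c s ^+ 2 * T z z)
  = - L s * r * c s ^+ 3 * dot z z * b ^+ 2.
  move=> sb; have [x _ [_ _ xE /(_ 1 (expr1n _ 2))]] := circle kz z0 sb.
  rewrite xE -/(t s) -/(c s) mul1r; move uE : (t s *: k + c s *: z) => u [uu ku].
  have u_v v : dot u v = 0 -> D s * T u v + phi2 s * dot k v * (c s ^+ 2 * r) = 0.
    move=> uv.
    have brku : br k u = c s *: br k z by rewrite -uE br_linr br_alt scaler0 add0r brZr.
    have rE : dot u (br k u) = c s ^+ 2 * r.
      by rewrite brku -uE !dotE S0 -/r; ring.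
    have E1 := unit_eq uu uv; rewrite S0 mulr0 ku in E1.
    have ux : dot u (k - s *: u) = 0 by rewrite !dotE uu (dotC u) ku; ring.
    have kx : dot k (k - s *: u) = b ^+ 2 - s ^+ 2 by rewrite !dotE ku b_sqr; ring.
    have Tx : T u (k - s *: u) = dot k (Q u) - s * dot u (Q u) - c s ^+ 2 * r.
      rewrite /T -rE -[k - s *: u]scale1r -scaleNr [br _ u]brZl.
      rewrite [k + _]addrC br_linl br_alt scaler0 add0r !scale1r !dotE.
      by rewrite (dotC _ k) (dotC _ u); ring.
    have E2 := unit_eq uu ux; rewrite S0 mulr0 ku kx Tx in E2.
    have us : u1 s != 0 by rewrite lt0r_neq0// u1_gt0.
    apply: (mulfI us); rewrite mulr0 /D.
    set q := dot k (Q u) - s * dot u (Q u) in E1 E2.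
    set m := c s ^+ 2 * r in E2 *.
    transitivity ((u1 s + (b ^+ 2 - s ^+ 2) * phi2 s) * (u1 s * T u v + phi2 s * dot k v * q)
      - phi2 s * dot k v * (u1 s * (q - m) + phi2 s * (b ^+ 2 - s ^+ 2) * q)); first by ring.
    by rewrite E1 E2; ring.
  have := u_v ((c s * dot z z) *: k + (- (t s * b ^+ 2)) *: z).
  rewrite T_lin -uE HB1 HB2 !dotE kz (dotC z k) kz -b_sqr => H.
  have Ds : D s != 0 by rewrite lt0r_neq0// D_gt0.
  apply: (mulfI Ds); rewrite /L; apply/eqP; rewrite -subr_eq0; apply/eqP.
  rewrite -[RHS]H; last by ring.
  by field.
have tb : t b != 0 by rewrite mulf_neq0 ?invr_neq0 ?lt0r_neq0.
(* The coefficient of tau^3, by evaluation at s = b. *)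
have A2 : T k z = 0.
  have /eqP := main b bb; rewrite cb -subr_eq0 => /eqP E.
  have nz : t b * b ^+ 2 * t b ^+ 2 != 0.
    have bn : b != 0 by exact: lt0r_neq0.
    by rewrite mulf_neq0 ?expf_neq0// mulf_neq0 ?expf_neq0.
  apply: (mulfI nz); rewrite mulr0; apply: oppr_inj; rewrite oppr0 -[RHS]E.
  by ring.
have cancel (G : R -> R) : (forall s : R, `|s| <= b -> {for s, continuous G}) ->
  (forall s, `|s| < b -> c s * G s = 0) -> forall s, `|s| <= b -> G s = 0.
  move=> cG HG; apply: zero_by_density => // s sb _.
  by apply: (mulfI (lt0r_neq0 (c_gt0 s sb))); rewrite HG// mulr0.
have cont3 (p q w : R -> R) (s : R) : {for s, continuous p} -> {for s, continuous q} ->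
   {for s, continuous w} -> forall x y : R, {for s, continuous (fun s => x * p s + y * q s + w s)}.
  move=> cp cq cw x y; apply: cvgD => //; apply: cvgD; apply: cvgM => //; exact: cvg_cst.
pose C (s : R) : R := dot z z * (T z k + L s * r * b ^+ 2).
have C_cont (s : R) : `|s| <= b -> {for s, continuous C}.
  move=> sb; apply: cvgM; first exact: cvg_cst.
  apply: cvgD; first exact: cvg_cst.
  apply: cvgM; last exact: cvg_cst.
  by apply: cvgM; [exact: L_cont|exact: cvg_cst].
pose a2 := dot z z * T k k - b ^+ 2 * B2.
pose a1 := dot z z * B1 - b ^+ 2 * T z z.
have t_sqr (s : R) : {for s, continuous (fun s => t s * t s)} by apply: cvgM; exact: t_cont.
have tc (s : R) : {for s, continuous (fun s => t s * c s)}.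
  by apply: cvgM; [exact: t_cont|exact: c_cont].
(* Each of the next three identities is the previous one divided by sigma, and
   its value at s = b gives the vanishing of one more coefficient. *)
have G1 : forall s, `|s| <= b -> a2 * (t s * t s) + a1 * (t s * c s) + C s * (c s * c s) = 0.
  apply: cancel => [s sb|s sb].
    apply: cont3 => //; apply: cvgM; first exact: C_cont.
    by apply: cvgM; exact: c_cont.
  have /eqP := main s (ltW sb); rewrite -subr_eq0 A2 => /eqP <-.
  by rewrite /a2 /a1 /C; ring.
have a20 : a2 = 0.
  apply: (mulIf tb); apply: (mulIf tb); rewrite !mul0r.
  by rewrite -[RHS](G1 b bb) cb; ring.
have G2 : forall s, `|s| <= b -> a1 * t s + 0 * t s + C s * c s = 0.
  apply: cancel => [s sb|s sb].
    by apply: cont3 => //; apply: cvgM; [exact: C_cont|exact: c_cont].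
  by rewrite -[RHS](G1 s (ltW sb)) a20; ring.
have a10 : a1 = 0.
  apply: (mulIf tb); rewrite !mul0r.
  by rewrite -[RHS](G2 b bb) cb; ring.
have G3 : forall s, `|s| <= b -> C s = 0.
  apply: cancel => // s sb.
  by rewrite -[RHS](G2 s (ltW sb)) a10; ring.
exists (- T z k / (r * b ^+ 2)) => s sb.
have := G3 s sb; move/eqP; rewrite mulf_eq0 gt_eqF//= addrC addr_eq0 => /eqP E.
rewrite -E /L; field.
by rewrite r0 !lt0r_neq0 ?D_gt0.
Qed.

Hypothesis phi_gt0 : forall s, `|s| <= b -> 0 < phi s.

(** In the closed case E = 1 - lambda (|k|^2 - s^2) satisfies
    E D = phi - s phi', hence is positive, and normalising E(0) to 1 gives the
    second-order equation of [randers_type_ode].  In the other case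
    phi = (1 + kappa s^2) (phi - s phi'), which gives both the positivity of
    1 + kappa s^2 and the equation of [riemann_type_ode]. *)
Lemma randers_type_of_douglas : (2 < n)%N ->
  ((forall w y, dot k (br w y) = 0) ->
    exists z, dot k z = 0 /\ dot z (br k z) != 0) ->
  exists kk C2, forall s, `|s| <= b ->
    0 < 1 + kk * s ^+ 2 /\
    phi s = phi 0 * Num.sqrt (1 + kk * s ^+ 2) + C2 * s.
Proof.
move=> n2 closedP.
have [S0|nS0] := pselect (forall w y, dot k (br w y) = 0).
  have [z [kz z0]] := closedP S0.
  have [l Hl] := closed_case S0 kz z0.
  pose E (s : R) := 1 - l * (b ^+ 2 - s ^+ 2).
  have ED s : `|s| <= b -> E s * D s = u1 s.
    move=> sb; have := Hl s sb; rewrite /E => e.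
    rewrite -/(D s) in e *; transitivity (D s - (b ^+ 2 - s ^+ 2) * (l * D s)).
      by ring.
    by rewrite -e /D addrK.
  have E0 s : `|s| <= b -> 0 < E s.
    by move=> sb; rewrite -(pmulr_lgt0 _ (D_gt0 sb)) ED// u1_gt0.
  have bn0 : `|0 : R| <= b by rewrite normr0 ltW.
  have e0 := lt0r_neq0 (E0 0 bn0).
  have wE s : 1 + l / E 0 * s ^+ 2 = E s / E 0.
    apply: (mulIf e0); rewrite divfK//.
    transitivity (E 0 + l * s ^+ 2); first by field.
    by rewrite /E; ring.
  have w0 s : `|s| <= b -> 0 < 1 + l / E 0 * s ^+ 2.
    by move=> sb; rewrite wE divr_gt0// E0.
  exists (l / E 0), (phi1 0) => s sb; split; first exact: w0.
  apply: (randers_type_ode w0 dphi dphi1) => // {s sb} s sb.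
  by rewrite wE -/(u1 s) -ED// Hl//; field.
have [kap Hk] : exists kap, forall s, `|s| <= b -> phi1 s = kap * s * u1 s.
  have [|kap Hk] := nonclosed_case n2.
    apply: contra_notP nS0 => H w y; apply/eqP/negPn/negP => wy.
    by apply: H; exists w, y.
  exists kap => s sb; apply/eqP; rewrite -subr_eq0; apply/eqP.
  apply: (@zero_by_density R (fun s => phi1 s - kap * s * u1 s) b) => //.
    move=> {s sb} s sb; apply: cvgB; first exact: phi1_cont.
    apply: cvgM; last exact: u1_cont.
    by apply: cvgM; [exact: cvg_cst|exact: cvg_id].
  by move=> {s sb} s sb s0; rewrite /= Hk// subrr.
have phiE s : `|s| <= b -> phi s = (1 + kap * s ^+ 2) * u1 s.
  move=> sb; have -> : phi s = u1 s + s * phi1 s by rewrite /u1 subrK.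
  by rewrite Hk//; ring.
have w0 s : `|s| <= b -> 0 < 1 + kap * s ^+ 2.
  by move=> sb; rewrite -(pmulr_lgt0 _ (u1_gt0 sb)) -phiE// phi_gt0.
exists kap, 0 => s sb; split; first exact: w0.
rewrite mul0r addr0; apply: (riemann_type_ode w0 dphi) => // {s sb} s sb.
by rewrite phiE// Hk//; ring.
Qed.

End Minkowski.

(** * Differentials of an (alpha, beta)-norm along curves *)

Section Curves.
Variable R : realType.

Lemma is_derive_mx m n (M : R -> 'M[R]_(m, n)) (t : R) (M' : 'M[R]_(m, n)) :
  (forall i j, is_derive t 1 (fun x => M x i j) (M' i j)) <-> is_derive t 1 M M'.
Proof.
split=> [H|[H1 H2] i j].
  have dM : derivable M t 1 by apply/derivable_mxP => i j; case: (H i j).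
  apply: DeriveDef => //; rewrite derive_mx//.
  by apply/matrixP => i j; rewrite mxE; case: (H i j).
have /derivable_mxP dM := H1.
apply: DeriveDef; first exact: dM.
by rewrite -H2 derive_mx// mxE.
Qed.

Lemma is_derive_mulmxf m n p (M : R -> 'M[R]_(m, n)) (N : R -> 'M[R]_(n, p))
    (t : R) M' N' : is_derive t 1 M M' -> is_derive t 1 N N' ->
  is_derive t 1 (fun x => M x *m N x) (M' *m N t + M t *m N').
Proof.
move=> /is_derive_mx dM /is_derive_mx dN; apply/is_derive_mx => i j.
have -> : (fun x => (M x *m N x) i j) = \sum_k (fun x => M x i k * N x k j).
  by apply/funext => x; rewrite mxE fct_sumE.
have H := is_derive_sum (fun k => is_derive_mulf (dM i k) (dN k j)).
by apply: is_derive_eq H _; rewrite !mxE -big_split.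
Qed.

Lemma is_derive_cstmx m n (M : 'M[R]_(m, n)) (t : R) : is_derive t 1 (fun=> M) 0.
Proof. exact: is_derive_cst. Qed.

Lemma is_derive_dot n (u v : R -> 'rV[R]_n) (t : R) u' v' :
  is_derive t 1 u u' -> is_derive t 1 v v' ->
  is_derive t 1 (fun x => dot (u x) (v x)) (dot u' (v t) + dot (u t) v').
Proof.
move=> /is_derive_mx du /is_derive_mx dv.
have -> : (fun x => dot (u x) (v x)) = \sum_k (fun x => u x 0 k * v x 0 k).
  by apply/funext => x; rewrite fct_sumE.
have H := is_derive_sum (fun k => is_derive_mulf (du 0 k) (dv 0 k)).
by apply: is_derive_eq H _; rewrite /dot -big_split.
Qed.

Lemma derive_along_line (V W : normedModType R) (f : V -> W) x v d :
  is_derive (0 : R) 1 (fun h : R => f (h *: v + x)) d -> 'D_v f x = d.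
Proof.
move=> [_ <-]; rewrite /derive; set g1 := fun h => h^-1 *: _; set g2 := fun h => h^-1 *: _.
suff -> : g1 = g2 by [].
by rewrite funeqE /g1 /g2 => h /=; rewrite addr0 scale0r add0r [_%:A]mulr1.
Qed.

Lemma is_derive_line (V W : normedModType R) (f : V -> W) x v :
  derivable f x v -> is_derive (0 : R) 1 (fun h : R => f (h *: v + x)) ('D_v f x).
Proof.
move=> df; have H := derivableP ((derivable1P f x v).1 df).
by rewrite (derive_along_line H).
Qed.

End Curves.

Section AlphaBeta.
Variables (R : realType) (n : nat) (k : 'rV[R]_n) (phi phi1 phi2 : R -> R).
Let b : R := Num.sqrt (dot k k).
Hypothesis dphi : forall s : R, `|s| <= b -> is_derive s 1 phi (phi1 s).
Hypothesis dphi1 : forall s : R, `|s| <= b -> is_derive s 1 phi1 (phi2 s).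

Lemma dot_CS (u v : 'rV[R]_n) : dot u v ^+ 2 <= dot u u * dot v v.
Proof.
have [->|v0] := eqVneq v 0; first by rewrite !dot0r mulr0 expr0n.
have vv : 0 < dot v v by rewrite dot_gt0.
have := dot_ge0 (dot v v *: u - dot u v *: v).
have -> : dot (dot v v *: u - dot u v *: v) (dot v v *: u - dot u v *: v) =
  dot v v * (dot u u * dot v v - dot u v ^+ 2).
  by rewrite !dotE (dotC v u); ring.
by rewrite pmulr_rge0// subr_ge0.
Qed.

Lemma ab_arg_le u : u != 0 -> `|ab_arg k u| <= b.
Proof.
move=> u0; have uu : 0 < Num.sqrt (dot u u) by rewrite sqrtr_gt0 dot_gt0.
rewrite /ab_arg normrM normfV (gtr0_norm uu) ler_pdivrMr// /b -sqrtrM ?dot_ge0//.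
by rewrite -sqrtr_sqr ler_wsqrtr// dot_CS.
Qed.

Definition ab_fun (u : 'rV[R]_n) : R := Num.sqrt (dot u u) * phi (ab_arg k u).

Definition ab_sq_d (u v : 'rV[R]_n) : R := 2 * ab_fun u * ab_d k phi phi1 u v.

Definition ab_sq_dd (u v w : 'rV[R]_n) : R :=
  2 * (ab_d k phi phi1 u v * ab_d k phi phi1 u w
       + ab_fun u * ab_dd k phi phi1 phi2 u v w).

Lemma ab_d_linear u (a : R) v w :
  ab_d k phi phi1 u (a *: v + w) = a * ab_d k phi phi1 u v + ab_d k phi phi1 u w.
Proof. by rewrite /ab_d !dotE; ring. Qed.

Lemma ab_dd_linearr u (a : R) v w z :
  ab_dd k phi phi1 phi2 u z (a *: v + w) =
  a * ab_dd k phi phi1 phi2 u z v + ab_dd k phi phi1 phi2 u z w.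
Proof. by rewrite /ab_dd !dotE; ring. Qed.

Lemma ab_dd_sym u v w : ab_dd k phi phi1 phi2 u v w = ab_dd k phi phi1 phi2 u w v.
Proof. by rewrite /ab_dd (dotC v w); ring. Qed.

Lemma ab_sq_d_linear u (a : R) v w :
  ab_sq_d u (a *: v + w) = a * ab_sq_d u v + ab_sq_d u w.
Proof. by rewrite /ab_sq_d ab_d_linear; ring. Qed.

Lemma ab_sq_dd_sym u v w : ab_sq_dd u v w = ab_sq_dd u w v.
Proof. by rewrite /ab_sq_dd ab_dd_sym; ring. Qed.

Lemma ab_sq_dd_linearr u (a : R) v w z :
  ab_sq_dd u z (a *: v + w) = a * ab_sq_dd u z v + ab_sq_dd u z w.
Proof. by rewrite /ab_sq_dd ab_d_linear ab_dd_linearr; ring. Qed.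

Lemma ab_sq_dd_linearl u (a : R) v w z :
  ab_sq_dd u (a *: v + w) z = a * ab_sq_dd u v z + ab_sq_dd u w z.
Proof. by rewrite !(ab_sq_dd_sym u _ z) ab_sq_dd_linearr. Qed.

Lemma ab_sq_dB u v w : ab_sq_d u (v - w) = ab_sq_d u v - ab_sq_d u w.
Proof. by rewrite addrC -scaleN1r ab_sq_d_linear mulN1r addrC. Qed.

Lemma ab_sq_ddBr u v w z :
  ab_sq_dd u z (v - w) = ab_sq_dd u z v - ab_sq_dd u z w.
Proof. by rewrite addrC -scaleN1r ab_sq_dd_linearr mulN1r addrC. Qed.

Lemma ab_d_euler u : u != 0 -> ab_d k phi phi1 u u = ab_fun u.
Proof.
move=> u0; have uu : 0 < Num.sqrt (dot u u) by rewrite sqrtr_gt0 dot_gt0.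
rewrite /ab_d /ab_fun -{1}(sqr_sqrtr (dot_ge0 u)).
have -> : dot k u = ab_arg k u * Num.sqrt (dot u u) by rewrite divfK// lt0r_neq0.
by field; exact: lt0r_neq0.
Qed.

Lemma ab_dd_euler u v : u != 0 -> ab_dd k phi phi1 phi2 u v u = 0.
Proof.
move=> u0; have uu : 0 < Num.sqrt (dot u u) by rewrite sqrtr_gt0 dot_gt0.
have e : dot u u = Num.sqrt (dot u u) ^+ 2 by rewrite sqr_sqrtr// dot_ge0.
have f : dot k u = ab_arg k u * Num.sqrt (dot u u) by rewrite divfK// lt0r_neq0.
rewrite /ab_dd f (dotC v u); move: uu e.
set r := Num.sqrt _ => r0 ->; field; exact: lt0r_neq0.
Qed.

Variables (u : R -> 'rV[R]_n) (t : R) (u' : 'rV[R]_n).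
Hypothesis du : is_derive t 1 u u'.
Hypothesis ut0 : u t != 0.

Let r_gt0 : 0 < Num.sqrt (dot (u t) (u t)).
Proof. by rewrite sqrtr_gt0 dot_gt0. Qed.

Let dr : is_derive t 1 (fun x => Num.sqrt (dot (u x) (u x)))
  (dot (u t) u' / Num.sqrt (dot (u t) (u t))).
Proof.
have uu0 : 0 < dot (u t) (u t) by rewrite dot_gt0.
apply: is_derive_eq (is_derive_sqrtf (f := fun x => dot (u x) (u x)) uu0 (is_derive_dot du du)) _.
by rewrite (dotC u'); field; exact: lt0r_neq0.
Qed.

Let ds : is_derive t 1 (fun x => ab_arg k (u x))
  ((dot k u' - ab_arg k (u t) * dot (u t) u' / Num.sqrt (dot (u t) (u t)))
   / Num.sqrt (dot (u t) (u t))).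
Proof.
have dk := is_derive_dot (is_derive_cstmx k t) du.
apply: is_derive_eq (is_derive_divf (g := fun x => Num.sqrt (dot (u x) (u x))) (lt0r_neq0 r_gt0) dk dr) _.
by rewrite /ab_arg dot0l; field; exact: lt0r_neq0.
Qed.

Lemma is_derive_ab_fun :
  is_derive t 1 (fun x => ab_fun (u x)) (ab_d k phi phi1 (u t) u').
Proof.
have dp := is_derive_compf (g := fun x => ab_arg k (u x)) (dphi (ab_arg_le ut0)) ds.
apply: is_derive_eq (is_derive_mulf dr dp) _.
by rewrite /ab_d; field; exact: lt0r_neq0.
Qed.

Lemma is_derive_ab_d (v : R -> 'rV[R]_n) v' : is_derive t 1 v v' ->
  is_derive t 1 (fun x => ab_d k phi phi1 (u x) (v x))
   (ab_dd k phi phi1 phi2 (u t) u' (v t) + ab_d k phi phi1 (u t) v').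
Proof.
move=> dv.
have dp := is_derive_compf (g := fun x => ab_arg k (u x)) (dphi (ab_arg_le ut0)) ds.
have dp1 := is_derive_compf (g := fun x => ab_arg k (u x)) (dphi1 (ab_arg_le ut0)) ds.
have dk := is_derive_dot (is_derive_cstmx k t) dv.
have d1 := is_derive_subf dp (is_derive_mulf ds dp1).
have d2 := is_derive_divf (g := fun x => Num.sqrt (dot (u x) (u x))) (lt0r_neq0 r_gt0) (is_derive_dot du dv) dr.
apply: is_derive_eq (is_derive_addf (is_derive_mulf d1 d2) (is_derive_mulf dp1 dk)) _.
rewrite /ab_d /ab_dd dot0l; field; exact: lt0r_neq0.
Qed.

Lemma is_derive_ab_sq : is_derive t 1 (fun x => ab_fun (u x) ^+ 2) (ab_sq_d (u t) u').
Proof.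
have -> : (fun x => ab_fun (u x) ^+ 2) = fun x => ab_fun (u x) * ab_fun (u x).
  by apply/funext => x; rewrite expr2.
apply: is_derive_eq (is_derive_mulf is_derive_ab_fun is_derive_ab_fun) _.
by rewrite /ab_sq_d; ring.
Qed.

Lemma is_derive_ab_sq_d (v : R -> 'rV[R]_n) v' : is_derive t 1 v v' ->
  is_derive t 1 (fun x => ab_sq_d (u x) (v x))
   (ab_sq_dd (u t) u' (v t) + ab_sq_d (u t) v').
Proof.
move=> dv; have d2 := is_derive_mulf (is_derive_cstf 2 t) is_derive_ab_fun.
apply: is_derive_eq (is_derive_mulf d2 (is_derive_ab_d dv)) _.
by rewrite /ab_sq_d /ab_sq_dd; ring.
Qed.

End AlphaBeta.

(** * Smooth maps and coordinate vectors in charts *)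

Section SmoothCalculus.
Variable R : realType.
Implicit Types V W : normedModType R.

(** Smoothness is asked of functions on open sets of charts, whose values
    elsewhere are arbitrary; so every differentiability statement has to be
    moved between functions that agree only near a point. *)
Lemma near_eq_differentiable V W (f g : V -> W) (x : V) :
  (\near x, f x = g x) -> differentiable f x -> differentiable g x.
Proof.
move=> fg df; have fgx : f x = g x := nbhs_singleton fg.
have dg : g \o shift x = cst (g x) + 'd f x +o_ 0 id.
  apply/eqaddoP => e e0.
  have /eqaddoP /(_ e e0) := diff_locally df.
  have : \forall z \near 0, f (z + x) = g (z + x).
    by move: fg; rewrite (near_shift 0) subr0.
  apply: filterS2 => z fgz; congr (_ <= _); congr `|_|.
  by rewrite !fctE /= fgz fgx.
have H := diff_unique (diff_continuous df) dg.
apply/diff_locallyP; rewrite H; split => //.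
exact: diff_continuous.
Qed.

Lemma derive_dir_linear V W (f : V -> W) (x : V) : differentiable f x ->
  forall (a : R) v w, 'D_(a *: v + w) f x = a *: 'D_v f x + 'D_w f x.
Proof. by move=> df a v w; rewrite !deriveE// linearP. Qed.

Lemma Ck_on_eq V W k (f g : V -> W) (U : set V) : open U ->
  (forall x, U x -> f x = g x) -> Ck_on k f U -> Ck_on k g U.
Proof.
move=> oU; elim: k f g => [|k IH] f g fg.
  move=> cf x Ux; have := cf x Ux; rewrite /prop_for /continuous_at -(fg x Ux).
  apply: cvg_trans; apply: near_eq_cvg.
  by apply: filterS (open_nbhs_nbhs (conj oU Ux)) => y Uy; rewrite fg.
have nfg x : U x -> \near x, f x = g x.
  by move=> Ux; apply: filterS (open_nbhs_nbhs (conj oU Ux)) => y Uy; exact: fg.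
move=> [df Df]; split => [x Ux|v].
  exact: near_eq_differentiable (nfg x Ux) (df x Ux).
by apply: IH (Df v) => x Ux; apply: near_eq_derive; exact: nfg.
Qed.

Lemma Ck_on_cst V W k (a : W) (U : set V) : Ck_on k (cst a : V -> W) U.
Proof.
elim: k a => [|k IH] a; first by move=> x _; exact: cst_continuous.
split => [x _|v]; first exact: differentiable_cst.
have -> : (fun x : V => 'D_v (cst a : V -> W) x) = cst 0.
  by apply/funext => x; rewrite derive_cst.
exact: IH.
Qed.

Lemma Ck_onS V W k (f : V -> W) U : Ck_on k.+1 f U -> Ck_on k f U.
Proof.
elim: k f => [|k IH] f [df Df].
  by move=> x Ux; apply: differentiable_continuous; exact: df.
by split => // v; exact: IH.
Qed.

Lemma Ck_onD V W k (f g : V -> W) U : open U ->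
  Ck_on k f U -> Ck_on k g U -> Ck_on k (fun x => f x + g x) U.
Proof.
move=> oU; elim: k f g => [|k IH] f g.
  by move=> cf cg x Ux; apply: cvgD; [exact: cf|exact: cg].
move=> [df Df] [dg Dg]; split => [x Ux|v].
  by apply: differentiableD; [exact: df|exact: dg].
apply: Ck_on_eq oU _ (IH _ _ (Df v) (Dg v)) => x Ux.
by rewrite -deriveD//; apply: diff_derivable; [exact: df|exact: dg].
Qed.

(** By induction on k, since the directional derivative of a product involves
    the factors themselves, which are C^k when they are C^(k+1). *)
Lemma Ck_onM V k (f g : V -> R) U : open U ->
  Ck_on k f U -> Ck_on k g U -> Ck_on k (fun x => f x * g x) U.
Proof.
move=> oU; elim: k f g => [|k IH] f g.
  by move=> cf cg x Ux; apply: cvgM; [exact: cf|exact: cg].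
move=> Cf Cg; have [df Df] := Cf; have [dg Dg] := Cg; split => [x Ux|v].
  by apply: differentiableM; [exact: df|exact: dg].
have := Ck_onD oU (IH _ _ (Ck_onS Cf) (Dg v)) (IH _ _ (Ck_onS Cg) (Df v)).
apply: Ck_on_eq oU _ => x Ux.
have fg : (fun x => f x * g x) = f * g by [].
by rewrite fg deriveM//; apply: diff_derivable; [exact: df|exact: dg].
Qed.

Lemma Ck_on_coord V m n k (f : V -> 'M[R]_(m, n)) U i j : open U ->
  Ck_on k f U -> Ck_on k (fun x => f x i j) U.
Proof.
move=> oU; elim: k f => [|k IH] f.
  move=> cf x Ux; have h := cf x Ux.
  exact: (continuous_comp h (@coord_continuous _ _ _ i j _)).
move=> [df Df]; split => [x Ux|v].
  exact: (differentiable_comp (df x Ux) (differentiable_coord (f x) i j)).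
apply: Ck_on_eq oU _ (IH _ (Df v)) => x Ux.
by rewrite derive_mx ?mxE//; apply: diff_derivable; exact: df.
Qed.

Lemma Ck_on_id V k (U : set V) : Ck_on k (fun x : V => x) U.
Proof.
case: k => [|k]; first by move=> x _; exact: cvg_id.
split => [x _|v]; first by have [] := is_diff_id x.
have -> : (fun x : V => 'D_v (fun x : V => x) x) = cst v.
  by apply/funext => x; rewrite derive_id.
exact: Ck_on_cst.
Qed.

Lemma smooth_on_differentiable V W (f : V -> W) U x :
  smooth_on f U -> U x -> differentiable f x.
Proof. by move=> /(_ 1%N) [df _]; exact: df. Qed.

End SmoothCalculus.

Section Charts.
Variables (R : realType) (n : nat) (M : manifoldType R n).
Implicit Types (c : chart R n M) (p : M) (f : M -> R).

Lemma atlas_coord_chart c : atlas c -> coord_chart c.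
Proof. by move=> ac c' ac'; split; exact: atlas_compatible. Qed.

Lemma cimg_nbhs c x : cimg c x -> nbhs x (cimg c).
Proof. by move=> cx; apply: open_nbhs_nbhs; split => //; exact: cimg_open. Qed.

Lemma cdom_nbhs c c' x : cimg c x -> cdom c' (cinv c x) ->
  \forall y \near x, cdom c' (cinv c y).
Proof.
move=> cx c'x; apply: (cinv_continuous cx).
by apply: open_nbhs_nbhs; split => //; exact: cdom_open.
Qed.

Lemma differentiable_change_chart c c' p f : smooth_transition c c' ->
  cdom c p -> cdom c' p -> differentiable (fun x => f (cinv c' x)) (c' p) ->
  differentiable (fun x => f (cinv c x)) (c p).
Proof.
move=> tr cp c'p df.
have dt : differentiable (fun x => c' (cinv c x)) (c p).
  apply: (smooth_on_differentiable tr); split; first exact: cfun_img.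
  by rewrite cfunK.
have E : c' (cinv c (c p)) = c' p by rewrite cfunK.
have H : differentiable ((fun x => f (cinv c' x)) \o (fun x => c' (cinv c x))) (c p).
  by apply: differentiable_comp; [exact: dt|rewrite E].
apply: near_eq_differentiable H.
have : \forall y \near c p, cdom c' (cinv c y).
  by apply: cdom_nbhs; [exact: cfun_img|rewrite cfunK].
by apply: filterS => y c'y /=; rewrite cfunK.
Qed.

(** A function smooth in one chart is differentiable in any other; two general
    coordinate charts are compared through a chart of the atlas. *)
Lemma smooth_near_differentiable c p f : coord_chart c -> cdom c p ->
  smooth_near f p -> differentiable (fun x => f (cinv c x)) (c p).
Proof.
move=> cc cp [c' [cc' c'p [U [oU Up] sf]]].
have [a aa ap] := atlas_cover p.
have df := smooth_on_differentiable sf Up.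
have da := differentiable_change_chart (cc' a aa).2 ap c'p df.
exact: differentiable_change_chart (cc a aa).1 cp ap da.
Qed.

(** Directional derivatives are additive in the direction only for
    differentiable functions, hence the restriction to germs of smooth functions
    in the definition of tangent vectors. *)
Lemma coord_vec_linear c x (a : R) y z : coord_chart c -> cimg c x ->
  coord_vec c x (a *: y + z) = (a \*o coord_vec c x y) \+ coord_vec c x z.
Proof.
move=> cc cx; apply/funext => f; rewrite /coord_vec /on_germs /=.
case: asboolP => [sf|_]; last by rewrite mulr0 addr0.
have := smooth_near_differentiable cc (cinv_dom cx) sf; rewrite cinvK// => df.
by rewrite derive_dir_linear.
Qed.

Lemma coord_vec_tangent c x y : coord_chart c -> cimg c x ->
  tangent (cinv c x) (coord_vec c x y).
Proof.
move=> cc cx; exists c; split => //; first exact: cinv_dom.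
by exists y; rewrite cinvK.
Qed.

Lemma smooth_near_chart c x f g : coord_chart c -> cimg c x ->
  smooth_on g (cimg c) -> (forall y, cimg c y -> f (cinv c y) = g y) ->
  smooth_near f (cinv c x).
Proof.
move=> cc cx sg fg; exists c; split => //; first exact: cinv_dom.
rewrite cinvK//; exists (cimg c); first by split => //; exact: cimg_open.
move=> k; apply: Ck_on_eq (sg k); first exact: cimg_open.
by move=> y cy; rewrite fg.
Qed.

Lemma coord_vec_app c x y f g : coord_chart c -> cimg c x ->
  smooth_on g (cimg c) -> (forall y, cimg c y -> f (cinv c y) = g y) ->
  coord_vec c x y f = 'D_y g x.
Proof.
move=> cc cx sg fg; rewrite /coord_vec /on_germs asboolT; last first.
  exact: smooth_near_chart sg fg.
apply: near_eq_derive; apply: filterS (cimg_nbhs cx) => z cz; exact: fg.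
Qed.

Lemma coord_vec_coord c x y i : coord_chart c -> cimg c x ->
  coord_vec c x y (fun p => c p 0 i) = y 0 i.
Proof.
move=> cc cx.
have scoord : smooth_on (fun z : 'rV[R]_n => z 0 i) (cimg c).
  by move=> k; apply: Ck_on_coord; [exact: cimg_open|exact: Ck_on_id].
rewrite (coord_vec_app _ cc cx scoord); last by move=> z cz; rewrite cinvK.
have dI : derivable (fun z : 'rV[R]_n => z) x y by exact: derivable_id.
have H := derive_mx dI.
by have := congr1 (fun A : 'M[R]_(1, n) => A 0 i) H; rewrite mxE derive_id.
Qed.

(** Tested on the coordinate functions, the bracket of derivations becomes the
    bracket of the component maps. *)
Lemma lie_bracket_coord c (X Y : vfield R M) (xi eta : 'rV[R]_n -> 'rV[R]_n) x i :
  coord_chart c ->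
  smooth_on xi (cimg c) -> smooth_on eta (cimg c) ->
  (forall x, cimg c x -> X (cinv c x) = coord_vec c x (xi x)) ->
  (forall x, cimg c x -> Y (cinv c x) = coord_vec c x (eta x)) ->
  cimg c x ->
  lie_bracket X Y (cinv c x) (fun p => c p 0 i) =
  ('D_(xi x) eta x - 'D_(eta x) xi x) 0 i.
Proof.
move=> cc sxi seta HX HY cx.
have scoord : smooth_on (fun z : 'rV[R]_n => z 0 i) (cimg c).
  by move=> k; apply: Ck_on_coord; [exact: cimg_open|exact: Ck_on_id].
rewrite /lie_bracket /on_germs asboolT; last first.
  by apply: smooth_near_chart scoord _ => // z cz; rewrite cinvK.
have sc (f : 'rV[R]_n -> 'rV[R]_n) :
    smooth_on f (cimg c) -> smooth_on (fun z => f z 0 i) (cimg c).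
  by move=> sf k; apply: Ck_on_coord; [exact: cimg_open|exact: sf].
rewrite HX// HY//.
rewrite (coord_vec_app _ cc cx (sc _ seta)); last first.
  by move=> y cy; rewrite HY// coord_vec_coord.
rewrite (coord_vec_app _ cc cx (sc _ sxi)); last first.
  by move=> y cy; rewrite HX// coord_vec_coord.
have dd (f : 'rV[R]_n -> 'rV[R]_n) : smooth_on f (cimg c) -> forall v, derivable f x v.
  by move=> sf v; apply: diff_derivable; exact: smooth_on_differentiable sf cx.
rewrite !mxE !derive_mx ?mxE//; exact: dd.
Qed.

End Charts.

(** * Orthonormal frames and the spray of an (alpha, beta)-metric *)

Section StructureConstants.
Variables (R : realType) (n : nat) (C : 'I_n -> 'I_n -> 'rV[R]_n).
Implicit Types u v w : 'rV[R]_n.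

Definition frame_bracket u v : 'rV[R]_n :=
  \sum_i \sum_j (u 0 i * v 0 j) *: C i j.

Lemma frame_bracket_linl a u v w :
  frame_bracket (a *: u + v) w = a *: frame_bracket u w + frame_bracket v w.
Proof.
rewrite scaler_sumr -big_split; apply: eq_bigr => i _ /=.
rewrite scaler_sumr -big_split; apply: eq_bigr => j _ /=.
by rewrite !mxE scalerA -scalerDl; congr (_ *: _); ring.
Qed.

Lemma frame_bracket_linr a u v w :
  frame_bracket w (a *: u + v) = a *: frame_bracket w u + frame_bracket w v.
Proof.
rewrite scaler_sumr -big_split; apply: eq_bigr => i _ /=.
rewrite scaler_sumr -big_split; apply: eq_bigr => j _ /=.
by rewrite !mxE scalerA -scalerDl; congr (_ *: _); ring.
Qed.

Lemma frame_bracket_alt u : (forall i j, C i j = - C j i) ->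
  frame_bracket u u = 0.
Proof.
move=> CN; have h : frame_bracket u u = - frame_bracket u u.
  rewrite {1}/frame_bracket exchange_big -sumrN; apply: eq_bigr => i _.
  rewrite -sumrN; apply: eq_bigr => j _ /=.
  by rewrite CN scalerN mulrC.
apply/rowP => i; have := congr1 (fun w : 'rV[R]_n => w 0 i) h.
by rewrite !mxE => e; lra.
Qed.

End StructureConstants.

Lemma nonzero_near (R : realType) n (y : 'rV[R]_n) : y != 0 ->
  \forall z \near y, z != 0.
Proof.
move=> y0; have ny : 0 < `|y| by rewrite normr_gt0.
apply/nbhs_ballP; exists `|y| => //= z; rewrite -ball_normE /= => yz.
by apply: contraTneq yz => ->; rewrite subr0 ltxx.
Qed.

Lemma mulmx_linearr (R : realType) m n p (y : 'M[R]_(m, n)) a (N P : 'M[R]_(n, p)) :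
  y *m (a *: N + P) = a *: (y *m N) + y *m P.
Proof. by rewrite mulmxDr scalemxAr. Qed.

Lemma mulmx_linearl (R : realType) m n p (y z : 'M[R]_(m, n)) a (N : 'M[R]_(n, p)) :
  (a *: y + z) *m N = a *: (y *m N) + z *m N.
Proof. by rewrite mulmxDl scalemxAl. Qed.

Lemma mulmx_comb2 (R : realType) m n p (y z : 'M[R]_(m, n)) a e (N : 'M[R]_(n, p)) :
  (a *: y + e *: z) *m N = a *: (y *m N) + e *: (z *m N).
Proof. by rewrite mulmxDl !scalemxAl. Qed.

(** The spray coefficients are defined by inverting the fundamental tensor and
    by partial derivatives; contracting with w turns them into an identity
    between values of dL and ddL, all the sums over coordinates being instances
    of linearity. *)
Section SprayContraction.
Variables (R : realType) (n : nat).
Local Notation V := 'rV[R]_n.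
Variables (B : 'M[R]_n) (dB : V -> 'M[R]_n) (dL : V -> R) (ddL : V -> V -> R).
Hypothesis dB_lin : forall a v w, dB (a *: v + w) = a *: dB v + dB w.
Hypothesis dL_lin : forall a v w, dL (a *: v + w) = a * dL v + dL w.
Hypothesis ddL_linl : forall a v w z, ddL (a *: v + w) z = a * ddL v z + ddL w z.
Hypothesis ddL_linr : forall a v w z, ddL z (a *: v + w) = a * ddL z v + ddL z w.
Variables (g : 'M[R]_n) (h G y : V).
Hypothesis g_unit : g \in unitmx.
Hypothesis gE : forall i j,
  g i j = 2^-1 * ddL (delta_mx 0 i *m B) (delta_mx 0 j *m B).
Hypothesis hE : forall l, h 0 l =
  \sum_m (ddL (delta_mx 0 l *m B) (y *m dB (delta_mx 0 m))
          + dL (delta_mx 0 l *m dB (delta_mx 0 m))) * y 0 m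
  - dL (y *m dB (delta_mx 0 l)).
Hypothesis GE : forall i, G 0 i = 4^-1 * \sum_l invmx g i l * h 0 l.

Lemma spray_contraction w :
  2 * ddL (w *m B) (G *m B) =
  ddL (w *m B) (y *m dB y) + dL (w *m dB y) - dL (y *m dB w).
Proof.
have hE' l : h 0 l = ddL (delta_mx 0 l *m B) (y *m dB y)
    + dL (delta_mx 0 l *m dB y) - dL (y *m dB (delta_mx 0 l)).
  rewrite hE; congr (_ - _).
  pose lf v := ddL (delta_mx 0 l *m B) (y *m dB v) + dL (delta_mx 0 l *m dB v).
  have lfl a v1 v2 : lf (a *: v1 + v2) = a * lf v1 + lf v2.
    by rewrite /lf dB_lin !mulmx_linearr ddL_linr dL_lin mulrDr addrACA.
  rewrite -/(lf y) (linear_form_sum lfl); apply: eq_bigr => m _.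
  by rewrite mulrC.
have gG l : \sum_j g l j * G 0 j = 4^-1 * h 0 l.
  have GT : G^T = 4^-1 *: (invmx g *m h^T).
    apply/matrixP => i j; rewrite mxE ord1 GE [RHS]mxE mxE; congr (_ * _).
    by apply: eq_bigr => m _; rewrite [h^T _ _]mxE.
  have := congr1 (fun Z : 'M[R]_(n, 1) => (g *m Z) l 0) GT.
  rewrite -scalemxAr mulKVmx// [RHS]mxE [h^T _ _]mxE => <-.
  by rewrite mxE; apply: eq_bigr => j _; rewrite [G^T _ _]mxE.
pose lh w := ddL (w *m B) (y *m dB y) + dL (w *m dB y) - dL (y *m dB w).
have lhl a v1 v2 : lh (a *: v1 + v2) = a * lh v1 + lh v2.
  rewrite /lh dB_lin (mulmx_linearr y) !(mulmx_linearl v1) ddL_linl !dL_lin.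
  have cmb (p1 p2 p3 p4 p5 p6 : R) :
    a * p1 + p2 + (a * p3 + p4) - (a * p5 + p6) = a * (p1 + p3 - p5) + (p2 + p4 - p6).
    by ring.
  exact: cmb.
rewrite -/(lh w) (linear_form_sum lhl).
under eq_bigr => l _.
  have -> : lh (delta_mx 0 l) = h 0 l by rewrite hE'.
  have -> : h 0 l = 4 * \sum_j g l j * G 0 j.
    by rewrite gG mulrA divff ?mul1r// pnatr_eq0.
  over.
pose lw w := ddL (w *m B) (G *m B).
have lwl a v1 v2 : lw (a *: v1 + v2) = a * lw v1 + lw v2.
  by rewrite /lw (mulmx_linearl v1) ddL_linl.
rewrite -/(lw w) (linear_form_sum lwl) mulr_sumr; apply: eq_bigr => l _.
pose lz z := ddL (delta_mx 0 l *m B) (z *m B).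
have lzl a v1 v2 : lz (a *: v1 + v2) = a * lz v1 + lz v2.
  by rewrite /lz (mulmx_linearl v1) ddL_linr.
rewrite /lw -/(lz G) (linear_form_sum lzl) !mulr_sumr.
apply: eq_bigr => j _; rewrite gE -/(lz _).
by move: (lz _) (w 0 l) (G 0 j) => e1 e2 e3; field.
Qed.

End SprayContraction.

(** Euler's relations at v = u, where the bracket is zero, determine the
    projective factor p; F, Q and v below are the values of f, df(Q u) and
    df(v), the zeros are the values of the Hessian of f on u. *)
Lemma projective_factor_vanishes (R : realType) (F Q p : R) : F != 0 ->
  2 * (F * Q + F * 0) + 2 * p * (2 * (F * F + F * 0)) = 0 -> Q + 2 * p * F = 0.
Proof.
move=> F0 e; apply: (mulfI F0); apply: (@mulfI _ 2); first by rewrite pnatr_eq0.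
by rewrite !mulr0 -[RHS]e; ring.
Qed.

Lemma projective_factor_cancel (R : realType) (F v Q p H br : R) : F != 0 ->
  Q + 2 * p * F = 0 ->
  2 * (v * Q + F * H) + 2 * p * (2 * (v * F + F * 0)) = 2 * F * br -> H = br.
Proof.
move=> F0 q0 e; apply: (mulfI F0); apply: (@mulfI _ 2); first by rewrite pnatr_eq0.
rewrite [RHS]mulrA -e; transitivity (2 * (F * H) + 2 * v * (Q + 2 * p * F)).
  by rewrite q0 mulr0 addr0.
by ring.
Qed.

Lemma spray_balance (R : realType) (e1 e2 e3 e4 e5 e6 : R) :
  2 * (2^-1 * e1 + (e6 * e2 + 0)) = e3 + e4 - e5 ->
  e1 - e3 + 2 * e6 * e2 = e4 - e5.
Proof. by lra. Qed.

Section Frame.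
Variables (R : realType) (n : nat) (M : manifoldType R n).
Variables (ta : M -> tvec R M -> tvec R M -> R) (E : 'I_n -> vfield R M).
Hypothesis ta_metric : is_riemannian_metric ta.
Hypothesis E_on : forall i j p, ta p (E i p) (E j p) = (i == j)%:R.
Variables (c : chart R n M) (xi : 'I_n -> 'rV[R]_n -> 'rV[R]_n).
Hypothesis cc : coord_chart c.
Hypothesis sxi : forall i, smooth_on (xi i) (cimg c).
Hypothesis Exi : forall i x, cimg c x -> E i (cinv c x) = coord_vec c x (xi i x).

Local Notation V := 'rV[R]_n.

Definition chart_metric (x : V) : 'M[R]_n :=
  \matrix_(i, j) ta (cinv c x) (coord_vec c x (delta_mx 0 i)) (coord_vec c x (delta_mx 0 j)).

Definition frame_mx (x : V) : 'M[R]_n := \matrix_(i, j) xi i x 0 j.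

(** The inverse of [frame_mx], written without inversion so that its
    entries are visibly differentiable: the components of y in an orthonormal
    frame are its products with the vectors of the frame. *)
Definition coframe_mx (x : V) : 'M[R]_n := chart_metric x *m (frame_mx x)^T.

Local Notation A := frame_mx.
Local Notation B := coframe_mx.

Lemma ta_linr p (a : R) u v w : tangent p u -> tangent p v -> tangent p w ->
  tangent p (a \*o u \+ v) ->
  ta p w (a \*o u \+ v) = a * ta p w u + ta p w v.
Proof.
move=> pu pv pw puv; have [sym lin _ _] := ta_metric.
by rewrite sym// lin// (sym _ _ w)// (sym _ _ w).
Qed.

Lemma chart_metricE x y z : cimg c x ->
  ta (cinv c x) (coord_vec c x y) (coord_vec c x z) = dot (y *m chart_metric x) z.
Proof.
move=> cx; have [sym lin _ _] := ta_metric.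
have tg w := coord_vec_tangent w cc cx.
have l1 z' := @linear_form_sum R n (fun y => ta (cinv c x) (coord_vec c x y) (coord_vec c x z')).
rewrite l1; last by move=> a u v; rewrite coord_vec_linear// lin.
have l2 y' := @linear_form_sum R n (fun z => ta (cinv c x) (coord_vec c x y') (coord_vec c x z)).
transitivity (\sum_i \sum_j y 0 i * (z 0 j * chart_metric x i j)).
  apply: eq_bigr => i _; rewrite l2; last first.
    move=> a u v; rewrite coord_vec_linear// ta_linr// -coord_vec_linear//.
  by rewrite mulr_sumr; apply: eq_bigr => j _; rewrite mxE.
rewrite exchange_big; apply: eq_bigr => j _; rewrite mxE mulr_suml.
by apply: eq_bigr => i _; rewrite mulrCA mulrC.
Qed.

Lemma row_frame_mx x i : row i (A x) = xi i x.
Proof. by apply/rowP => j; rewrite !mxE. Qed.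

Lemma frame_mxK x : cimg c x -> A x *m B x = 1%:M.
Proof.
move=> cx; apply/matrixP => i j; rewrite [RHS]mxE -(E_on i j (cinv c x)) !Exi//.
rewrite chart_metricE// /coframe_mx mulmxA [LHS]mxE; apply: eq_bigr => l _.
rewrite -(row_frame_mx x i) -row_mul [row _ _ 0 _]mxE; congr (_ * _).
by rewrite !mxE.
Qed.

Lemma coframe_mxK x : cimg c x -> B x *m A x = 1%:M.
Proof. by move=> /frame_mxK/mulmx1C. Qed.

Lemma metric_frame x y v : cimg c x ->
  ta (cinv c x) (coord_vec c x y) (coord_vec c x (v *m A x)) = dot (y *m B x) v.
Proof. by move=> cx; rewrite chart_metricE// dot_mulmxr -mulmxA. Qed.

Lemma coord_vec_frame x v f : cimg c x ->
  coord_vec c x (v *m A x) f = \sum_i v 0 i * E i (cinv c x) f.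
Proof.
move=> cx.
rewrite (@linear_form_sum R n (fun v => coord_vec c x (v *m A x) f)); last first.
  by move=> a u w; rewrite mulmxDl -scalemxAl coord_vec_linear.
by apply: eq_bigr => i _; rewrite -rowE row_frame_mx Exi.
Qed.

Lemma coframe_differentiable x i j : cimg c x ->
  differentiable (fun x => B x i j) x.
Proof.
move=> cx; have [_ _ _ sm] := ta_metric.
have -> : (fun x => B x i j) = \sum_l (fun x => chart_metric x i l * xi j x 0 l).
  by apply/funext => z; rewrite mxE fct_sumE; apply: eq_bigr => l _; rewrite !mxE.
apply: differentiable_sum => l; apply: differentiableM.
  under [X in differentiable X _]eq_fun do rewrite mxE.
  exact: smooth_on_differentiable (sm c (delta_mx 0 i) (delta_mx 0 l) cc) cx.
exact: (differentiable_comp (smooth_on_differentiable (sxi j) cx) (differentiable_coord _ _ _)).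
Qed.

Section AtPoint.
Variable x0 : V.
Hypothesis cx0 : cimg c x0.

Definition dcoframe (v : V) : 'M[R]_n := \matrix_(i, j) 'D_v (fun x => B x i j) x0.
Definition dframe (v : V) : 'M[R]_n := \matrix_(i, j) 'D_v (xi i) x0 0 j.

Local Notation dB := dcoframe.
Local Notation dA := dframe.

Lemma dcoframe_linear a u v : dB (a *: u + v) = a *: dB u + dB v.
Proof.
apply/matrixP => i j; rewrite !mxE.
by rewrite derive_dir_linear//; exact: coframe_differentiable.
Qed.

Lemma line0 (v : V) : (0 : R) *: v + x0 = x0.
Proof. by rewrite scale0r add0r. Qed.

Lemma is_derive_coframe v : is_derive (0 : R) 1 (fun h : R => B (h *: v + x0)) (dB v).
Proof.
apply/is_derive_mx => i j; rewrite mxE; apply: is_derive_line.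
by apply: diff_derivable; exact: coframe_differentiable.
Qed.

Lemma is_derive_frame v : is_derive (0 : R) 1 (fun h : R => A (h *: v + x0)) (dA v).
Proof.
apply/is_derive_mx => i j; rewrite mxE.
have dxi : derivable (xi i) x0 v.
  by apply: diff_derivable; exact: smooth_on_differentiable (sxi i) cx0.
have /is_derive_mx/(_ 0 j) := is_derive_line dxi.
by under [in X in _ -> X]eq_fun do rewrite mxE.
Qed.

Lemma line_near (U : set V) v : nbhs x0 U -> \forall h \near (0 : R), U (h *: v + x0).
Proof.
move=> Ux; have h : {for (0 : R), continuous (fun h : R => h *: v + x0)}.
  apply: cvgD; last exact: cvg_cst.
  by apply: cvgZr_tmp; exact: cvg_id.
by apply: h; rewrite line0.
Qed.

(** Differentiate A B = 1. *)
Lemma dframe_dcoframe v : dA v *m B x0 + A x0 *m dB v = 0.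
Proof.
have H := is_derive_mulmxf (is_derive_frame v) (is_derive_coframe v).
rewrite /= !line0 in H.
have H1 : is_derive (0 : R) 1 (fun h : R => A (h *: v + x0) *m B (h *: v + x0)) 0.
  apply: near_eq_is_derive (is_derive_cstmx 1%:M 0).
  apply: filterS (line_near v (cimg_nbhs cx0)) => h ch.
  by rewrite frame_mxK.
by rewrite -(@derive_val _ _ _ _ _ _ _ H) (@derive_val _ _ _ _ _ _ _ H1).
Qed.

Variable C : 'I_n -> 'I_n -> V.
Hypothesis E_bracket : forall i j p f,
  lie_bracket (E i) (E j) p f = \sum_l C i j 0 l * E l p f.

Lemma frame_bracket_coord i j :
  'D_(xi i x0) (xi j) x0 - 'D_(xi j x0) (xi i) x0 = C i j *m A x0.
Proof.
apply/rowP => l.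
rewrite -(lie_bracket_coord l cc (sxi i) (sxi j) (fun x => Exi i (x:=x)) (fun x => Exi j (x:=x)) cx0).
rewrite E_bracket mxE; apply: eq_bigr => m _.
by rewrite Exi// coord_vec_coord// mxE.
Qed.

Lemma dframe_mul u v : v *m dA (u *m A x0) =
  \sum_i \sum_j (u 0 i * v 0 j) *: 'D_(xi i x0) (xi j) x0.
Proof.
have dxi j : differentiable (xi j) x0 by exact: smooth_on_differentiable (sxi j) cx0.
rewrite exchange_big mulmx_sum_row; apply: eq_bigr => j _.
have -> : row j (dA (u *m A x0)) = 'D_(u *m A x0) (xi j) x0.
  by apply/rowP => l; rewrite !mxE.
rewrite mulmx_sum_row deriveE// linear_sum scaler_sumr; apply: eq_bigr => i _.
by rewrite linearZ /= row_frame_mx scalerA deriveE// mulrC.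
Qed.

(** The Maurer-Cartan equation of the coframe. *)
Lemma coframe_structure y w :
  w *m dB y - y *m dB w = frame_bracket C (w *m B x0) (y *m B x0).
Proof.
set u := y *m B x0; set v := w *m B x0.
have yE : y = u *m A x0 by rewrite /u -mulmxA coframe_mxK// mulmx1.
have wE : w = v *m A x0 by rewrite /v -mulmxA coframe_mxK// mulmx1.
have dBE t z : (t *m A x0) *m dB z = - ((t *m dA z) *m B x0).
  have h : A x0 *m dB z = - (dA z *m B x0).
    by apply/eqP; rewrite -addr_eq0 addrC dframe_dcoframe.
  by rewrite -mulmxA h mulmxN mulmxA.
have -> : w *m dB y - y *m dB w = (u *m dA w - v *m dA y) *m B x0.
  by rewrite {1}wE {2}yE !dBE mulmxBl opprK addrC.
have -> : u *m dA w - v *m dA y = frame_bracket C v u *m A x0.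
  rewrite wE yE !dframe_mul [X in _ - X]exchange_big /= -sumrB mulmx_suml.
  apply: eq_bigr => i _; rewrite -sumrB mulmx_suml; apply: eq_bigr => j _.
  by rewrite [u 0 j * _]mulrC -scalerBr frame_bracket_coord scalemxAl.
by rewrite -mulmxA frame_mxK// mulmx1.
Qed.

Section Spray.
Variables (k : V) (phi phi1 phi2 : R -> R) (F : M -> tvec R M -> R).
Variable X : vfield R M.
Let b : R := Num.sqrt (dot k k).
Hypothesis dphi : forall s : R, `|s| <= b -> is_derive s 1 phi (phi1 s).
Hypothesis dphi1 : forall s : R, `|s| <= b -> is_derive s 1 phi1 (phi2 s).
Hypothesis phi_gt0 : forall s : R, `|s| <= b -> 0 < phi s.
Hypothesis XE : forall p f, X p f = \sum_i k 0 i * E i p f.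
Hypothesis FE : forall p v, tangent p v ->
  F p v = riem_norm ta p v * phi (ta p v (X p) / riem_norm ta p v).
Hypothesis F_finsler : is_finsler F.
Hypothesis F_douglas : douglas_type F.
Hypothesis C_skew : forall i j, C i j = - C j i.

Local Notation f := (ab_fun k phi).
Local Notation df := (ab_d k phi phi1).
Local Notation ddf := (ab_dd k phi phi1 phi2).
Local Notation dL := (ab_sq_d k phi phi1).
Local Notation ddL := (ab_sq_dd k phi phi1 phi2).

Lemma coordF_frame (x y : V) : cimg c x -> coordF F c x y = f (y *m B x).
Proof.
move=> cx; have yE : y = (y *m B x) *m A x by rewrite -mulmxA coframe_mxK// mulmx1.
have Xp : X (cinv c x) = coord_vec c x (k *m A x).
  by apply/funext => g; rewrite XE coord_vec_frame.
rewrite /coordF FE; last exact: coord_vec_tangent.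
have taX : ta (cinv c x) (coord_vec c x y) (X (cinv c x)) = dot (y *m B x) k.
  by rewrite Xp; exact: metric_frame.
have := metric_frame y (y *m B x) cx; rewrite -yE => tay.
rewrite /riem_norm taX tay.
by rewrite /ab_fun /ab_arg (dotC k).
Qed.

Lemma frame_neq0 (y : V) : y != 0 -> y *m B x0 != 0.
Proof.
apply: contraNneq => yB; rewrite -[y]mulmx1 -(coframe_mxK cx0) mulmxA yB.
by rewrite mul0mx.
Qed.

(** F^2 is a fixed function of y B(x), so all its partial derivatives are
    differentials of the squared norm along curves y B(x) with x or y moving on
    a line. *)
Lemma partial_x_coordF2 (y : V) m : y != 0 ->
  partial_x m (coordF2 F c) x0 y = dL (y *m B x0) (y *m dB (delta_mx 0 m)).
Proof.
move=> y0; rewrite /partial_x.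
transitivity ('D_(delta_mx 0 m) (fun x => f (y *m B x) ^+ 2) x0).
  apply: near_eq_derive; apply: filterS (cimg_nbhs cx0) => x cx.
  by rewrite /coordF2 coordF_frame.
apply: derive_along_line.
have H := is_derive_mulmxf (is_derive_cstmx y 0) (is_derive_coframe (delta_mx 0 m)).
rewrite mul0mx add0r in H.
have := is_derive_ab_sq dphi H; rewrite /= line0; apply.
exact: frame_neq0.
Qed.

Lemma is_derive_id_line (y v : V) : is_derive (0 : R) 1 (fun h : R => h *: v + y) v.
Proof.
have d : derivable (fun z : V => z) y v by exact: derivable_id.
by have := is_derive_line d; rewrite derive_id.
Qed.

Let curve_y (y v : V) (N : 'M[R]_n) :
  is_derive (0 : R) 1 (fun h : R => (h *: v + y) *m N) (v *m N).
Proof.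
have := is_derive_mulmxf (is_derive_id_line y v) (is_derive_cstmx N 0).
by rewrite mulmx0 addr0.
Qed.

Lemma partial_y_coordF2 (y : V) l : y != 0 ->
  partial_y l (coordF2 F c) x0 y = dL (y *m B x0) (delta_mx 0 l *m B x0).
Proof.
move=> y0; rewrite /partial_y.
transitivity ('D_(delta_mx 0 l) (fun y => f (y *m B x0) ^+ 2) y).
  apply: near_eq_derive; apply: filterS (nonzero_near y0) => z _; rewrite /coordF2.
  by rewrite (coordF_frame z cx0).
apply: derive_along_line.
have := is_derive_ab_sq dphi (curve_y y (delta_mx 0 l) (B x0)).
by rewrite scale0r add0r; apply; exact: frame_neq0.
Qed.

Lemma partial_yx_coordF2 (y : V) l m : y != 0 ->
  partial_y l (partial_x m (coordF2 F c)) x0 y =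
  ddL (y *m B x0) (delta_mx 0 l *m B x0) (y *m dB (delta_mx 0 m))
  + dL (y *m B x0) (delta_mx 0 l *m dB (delta_mx 0 m)).
Proof.
move=> y0; rewrite {1}/partial_y.
transitivity ('D_(delta_mx 0 l)
    (fun y => dL (y *m B x0) (y *m dB (delta_mx 0 m))) y).
  apply: near_eq_derive; apply: filterS (nonzero_near y0) => z z0.
  exact: partial_x_coordF2.
apply: derive_along_line.
have := is_derive_ab_sq_d dphi dphi1 (curve_y y (delta_mx 0 l) (B x0)) _
  (curve_y y (delta_mx 0 l) (dB (delta_mx 0 m))).
by rewrite /= scale0r add0r; apply; exact: frame_neq0.
Qed.

Lemma fundamental_tensor_frame (y : V) i j : y != 0 ->
  fundamental_tensor F c x0 y i j =
  2^-1 * ddL (y *m B x0) (delta_mx 0 i *m B x0) (delta_mx 0 j *m B x0).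
Proof.
move=> y0; rewrite mxE; congr (_ * _); rewrite {1}/partial_y.
transitivity ('D_(delta_mx 0 i)
    (fun y => dL (y *m B x0) (delta_mx 0 j *m B x0)) y).
  apply: near_eq_derive; apply: filterS (nonzero_near y0) => z z0.
  exact: partial_y_coordF2.
apply: derive_along_line.
have := is_derive_ab_sq_d dphi dphi1 (curve_y y (delta_mx 0 i) (B x0)) _
  (is_derive_cstmx (delta_mx 0 j *m B x0) 0).
rewrite /= scale0r add0r => /(_ (frame_neq0 y0)).
have dL0 (u : V) : dL u 0 = 0 by rewrite /ab_sq_d /ab_d !dot0r; ring.
by rewrite dL0 addr0.
Qed.

Definition spray_vec (y : V) : V := \row_i spray_coef F c i x0 y.

Lemma fundamental_tensor_unit (y : V) : y != 0 ->
  fundamental_tensor F c x0 y \in unitmx.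
Proof.
move=> y0; rewrite -row_free_unit -kermx_eq0; apply/negPn/negP => /rowV0Pn[w].
move=> /sub_kermxP wg w0; have [_ _ _ pos] := F_finsler.
by have := pos c x0 y w cc cx0 y0 w0; rewrite wg mul0mx mxE ltxx.
Qed.

(** Euler-Poincare form of the spray: by [coframe_structure] the last two terms
    combine into dL(u) ([v, u]), with u and v the frame components of y and
    w. *)
Lemma spray_frame (y w : V) : y != 0 ->
  2 * ddL (y *m B x0) (w *m B x0) (spray_vec y *m B x0) =
  ddL (y *m B x0) (w *m B x0) (y *m dB y)
  + dL (y *m B x0) (w *m dB y) - dL (y *m B x0) (y *m dB w).
Proof.
move=> y0.
pose hv : V := \row_l (\sum_m partial_y l (partial_x m (coordF2 F c)) x0 y * y 0 m
     - partial_x l (coordF2 F c) x0 y).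
apply: (spray_contraction dcoframe_linear _ _ _ (fundamental_tensor_unit y0)
  (fun i j => fundamental_tensor_frame i j y0) (h := hv)).
- by move=> *; exact: ab_sq_d_linear.
- by move=> *; exact: ab_sq_dd_linearl.
- by move=> *; exact: ab_sq_dd_linearr.
- move=> l; rewrite mxE partial_x_coordF2//; congr (_ - _).
  by apply: eq_bigr => m _; rewrite partial_yx_coordF2.
- move=> i; rewrite mxE /spray_coef; congr (_ * _).
  by apply: eq_bigr => l _; rewrite mxE.
Qed.

(** With G^i = 1/2 Gamma^i(y, y) + P y^i, the map Q collects the quadratic
    part Gamma(y, y) and the term y (d_y B) of the spray. The multiple of u
    coming from P is removed by Euler's relations for the homogeneous function
    f. *)
Lemma douglas_frame : exists Q : V -> V, quadratic_on_planes Q /\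
  forall u v : V, u != 0 -> ddf u v (Q u) = df u (frame_bracket C v u).
Proof.
have [Gam [P [_ HP]]] := F_douglas cc.
pose q (y : V) : V := \row_i \sum_j \sum_l Gam i j l x0 * y 0 j * y 0 l.
pose Qy (y : V) : V := q y *m B x0 - y *m dB y.
pose Q (u : V) : V := Qy (u *m A x0).
have q_quad : quadratic_on_planes q.
  move=> y z; exists (\row_i \sum_j \sum_l Gam i j l x0 * (y 0 j * z 0 l + z 0 j * y 0 l)).
  move=> a1 a2; apply/rowP => i; rewrite !mxE !mulr_sumr -!big_split /=.
  apply: eq_bigr => j _; rewrite !mulr_sumr -!big_split /=.
  by apply: eq_bigr => l _; rewrite !mxE; ring.
exists Q; split.
  move=> u v; have [q' Hq] := q_quad (u *m A x0) (v *m A x0).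
  exists (q' *m B x0 - (u *m A x0) *m dB (v *m A x0) - (v *m A x0) *m dB (u *m A x0)).
  move=> a1 a2; rewrite /Q /Qy.
  have -> : (a1 *: u + a2 *: v) *m A x0 = a1 *: (u *m A x0) + a2 *: (v *m A x0).
    by rewrite (mulmx_linearl u) -scalemxAl.
  set y := u *m A x0 in Hq *; set z := v *m A x0 in Hq *.
  have dBZ a w : dB (a *: w) = a *: dB w.
    apply/matrixP => i j; rewrite [RHS]mxE !mxE.
    by rewrite !deriveE ?linearZ//; exact: coframe_differentiable.
  rewrite Hq dcoframe_linear dBZ {Hq}.
  move: (q y) (q z) (dB y) (dB z) (B x0) => qy qz Ny Nz N.
  rewrite !mulmxDl -!scalemxAl !mulmxDr -!scalemxAr.
  move: (qy *m N) (qz *m N) (q' *m N) (y *m Ny) (z *m Ny) (y *m Nz) (z *m Nz).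
  by move=> m1 m2 m3 m4 m5 m6 m7; apply/rowP => i; rewrite !mxE; ring.
move=> u v u0.
have f0 : 0 < f u.
  by rewrite mulr_gt0 ?sqrtr_gt0 ?dot_gt0// phi_gt0// ab_arg_le.
have [y [yB ->]] : exists y, y *m B x0 = u /\ Q u = Qy y.
  by exists (u *m A x0); rewrite -mulmxA frame_mxK// mulmx1.
have [w wB] : exists w, w *m B x0 = v.
  by exists (v *m A x0); rewrite -mulmxA frame_mxK// mulmx1.
have y0 : y != 0 by apply: contraNneq u0 => y0; rewrite -yB y0 mul0mx.
have GE : spray_vec y *m B x0 = 2^-1 *: (q y *m B x0) + P x0 y *: u.
  transitivity ((2^-1 *: q y + P x0 y *: y) *m B x0); last first.
    by rewrite -yB mulmx_comb2.
  congr (_ *m _); apply/rowP => i.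
  by rewrite [LHS]mxE HP// [RHS]mxE; congr (_ + _); rewrite !mxE.
have key (w' : V) : ddL u (w' *m B x0) (Qy y) + 2 * P x0 y * ddL u (w' *m B x0) u =
    dL u (frame_bracket C (w' *m B x0) u).
  have := spray_frame w' y0; rewrite yB GE.
  rewrite -[P x0 y *: u]addr0 !ab_sq_dd_linearr => E1.
  have dd0 (z : V) : ddL u z 0 = 0.
    by rewrite /ab_sq_dd /ab_d /ab_dd !dot0r; ring.
  rewrite dd0 in E1.
  have E2 := coframe_structure y w'; rewrite yB in E2.
  rewrite -E2 ab_sq_dB ab_sq_ddBr.
  exact: (spray_balance E1).
have ddLE (z z' : V) : ddL u z z' = 2 * (df u z * df u z' + f u * ddf u z z') by [].
have dfQ : df u (Qy y) + 2 * P x0 y * f u = 0.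
  have := key y; rewrite yB frame_bracket_alt//.
  have -> : dL u 0 = 0 by rewrite /ab_sq_d /ab_d !dot0r; ring.
  rewrite !ddLE (ab_dd_sym k phi phi1 phi2 u u) !ab_dd_euler// ab_d_euler//.
  exact: (projective_factor_vanishes (lt0r_neq0 f0)).
have := key w; rewrite wB !ddLE ab_dd_euler// ab_d_euler// /ab_sq_d.
exact: (projective_factor_cancel (lt0r_neq0 f0) dfQ).
Qed.

End Spray.

End AtPoint.

End Frame.

(** * From the shape of phi to a Randers metric *)

Section RandersMetric.
Variables (R : realType) (n : nat) (M : manifoldType R n).
Variables (ta : M -> tvec R M -> tvec R M -> R) (E : 'I_n -> vfield R M).
Variables (X : vfield R M) (k : 'rV[R]_n).
Hypothesis ta_metric : is_riemannian_metric ta.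
Hypothesis E_on : forall i j p, ta p (E i p) (E j p) = (i == j)%:R.
Hypothesis E_vfield : forall i, is_vfield (E i).
Hypothesis XE : forall p f, X p f = \sum_i k 0 i * E i p f.

Lemma frame_in_chart (c : chart R n M) : coord_chart c ->
  exists xi : 'I_n -> 'rV[R]_n -> 'rV[R]_n,
    (forall i, smooth_on (xi i) (cimg c)) /\
    (forall i x, cimg c x -> E i (cinv c x) = coord_vec c x (xi i x)).
Proof.
move=> cc; have /choice[xi Hxi] : forall i, exists xi : 'rV[R]_n -> 'rV[R]_n,
    smooth_on xi (cimg c) /\
    forall x, cimg c x -> E i (cinv c x) = coord_vec c x (xi x).
  by move=> i; have [xi sxi Hxi] := E_vfield i cc; exists xi.
by exists xi; split=> i; have [] := Hxi i.
Qed.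

Lemma tangent_frame p v : tangent p v ->
  exists u, [/\ ta p v v = dot u u, ta p v (X p) = dot u k & u = 0 -> v = cst 0].
Proof.
move=> [c [cc cp [y ->]]]; have [xi [sxi Exi]] := frame_in_chart cc.
have := cfun_img cp; move: (cfunK cp) => {cp}; move: (c p) => x <- cx.
pose u := y *m coframe_mx ta c xi x.
have yE : u *m frame_mx xi x = y.
  by rewrite -mulmxA (coframe_mxK ta_metric E_on cc Exi cx) mulmx1.
have Xp : X (cinv c x) = coord_vec c x (k *m frame_mx xi x).
  by apply/funext => f; rewrite XE (coord_vec_frame cc Exi).
exists u; split.
- by have := metric_frame ta_metric xi cc y u cx; rewrite yE.
- by rewrite Xp (metric_frame ta_metric xi cc).
- move=> u0; rewrite -yE u0 mul0mx.
  have := coord_vec_linear (-1) 0 0 cc cx; rewrite scaler0 addr0 => ->.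
  by apply/funext => f /=; rewrite mulN1r addNr.
Qed.

Lemma frame_tangent p u :
  exists v, [/\ tangent p v, ta p v v = dot u u & ta p v (X p) = dot u k].
Proof.
have [c ac cp] := atlas_cover p; have cc := atlas_coord_chart ac.
have [xi [sxi Exi]] := frame_in_chart cc.
have := cfun_img cp; move: (cfunK cp) => {cp}; move: (c p) => x <- cx.
have Xp : X (cinv c x) = coord_vec c x (k *m frame_mx xi x).
  by apply/funext => f; rewrite XE (coord_vec_frame cc Exi).
have uE : u *m frame_mx xi x *m coframe_mx ta c xi x = u.
  by rewrite -mulmxA (frame_mxK ta_metric E_on cc Exi cx) mulmx1.
exists (coord_vec c x (u *m frame_mx xi x)); split.
- exact: coord_vec_tangent.
- by rewrite (metric_frame ta_metric xi cc)// uE.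
- by rewrite Xp (metric_frame ta_metric xi cc)// uE.
Qed.

Let b : R := Num.sqrt (dot k k).

(** The norm of the one-form is attained in the direction of X. *)
Lemma one_form_norm_ge p : (b%:E <= one_form_norm ta (fun p y => ta p y (X p)) p)%E.
Proof.
apply: ereal_sup_ubound => /=.
have [k0|k0] := eqVneq k 0.
  have [v [pv vv vX]] := frame_tangent p 0.
  exists v; last by rewrite vX /b k0 !dot0l sqrtr0 normr0.
  by split => //; rewrite /riem_norm vv dot0l sqrtr0.
have kk : 0 < dot k k by rewrite dot_gt0.
have b0 : 0 < b by rewrite sqrtr_gt0.
have [v [pv vv vX]] := frame_tangent p (b^-1 *: k).
have bb : b * b = dot k k by rewrite -expr2 sqr_sqrtr// ltW.
exists v; last first.
  by rewrite vX dotZl -bb mulKf ?gt_eqF// gtr0_norm.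
split => //; rewrite /riem_norm vv !dotE -bb mulKf ?gt_eqF// mulVf ?gt_eqF//.
by rewrite sqrtr1.
Qed.

Variables (F : M -> tvec R M -> R) (phi : R -> R) (kk C2 : R).
Hypothesis beta_form : is_one_form (fun p y => ta p y (X p)).
Hypothesis F_finsler : is_finsler F.
Hypothesis FE : forall p v, tangent p v ->
  F p v = riem_norm ta p v * phi (ta p v (X p) / riem_norm ta p v).
Hypothesis phi_gt0 : forall s : R, `|s| <= b -> 0 < phi s.
Hypothesis phiE : forall s : R, `|s| <= b -> 0 < 1 + kk * s ^+ 2 /\
  phi s = phi 0 * Num.sqrt (1 + kk * s ^+ 2) + C2 * s.

Let b_ge0 : 0 <= b. Proof. exact: sqrtr_ge0. Qed.

Let phi0_gt0 : 0 < phi 0.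
Proof. by apply: phi_gt0; rewrite normr0. Qed.

Let beta p y := ta p y (X p).

Let ta' p u v : R := phi 0 ^+ 2 * (ta p u v + kk * (beta p u * beta p v)).

Let quadE (u : 'rV[R]_n) : u != 0 ->
  dot u u * (1 + kk * ab_arg k u ^+ 2) = dot u u + kk * dot u k ^+ 2.
Proof.
move=> u0; have uu : 0 < dot u u by rewrite dot_gt0.
rewrite /ab_arg expr_div_n (sqr_sqrtr (ltW uu)) (dotC k).
by field; rewrite gt_eqF.
Qed.

(** At u the quadratic form is |u|^2 (1 + m s^2) with |s| <= |k|. *)
Let quad_gt0 (u : 'rV[R]_n) : u != 0 -> 0 < dot u u + kk * dot u k ^+ 2.
Proof.
move=> u0; have uu : 0 < dot u u by rewrite dot_gt0.
have [w0 _] := phiE (ab_arg_le k u0).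
by rewrite -quadE// mulr_gt0.
Qed.

Let norm' (u : 'rV[R]_n) :
  Num.sqrt (phi 0 ^+ 2 * (dot u u + kk * (dot u k * dot u k))) =
  phi 0 * Num.sqrt (dot u u + kk * dot u k ^+ 2).
Proof.
by rewrite -expr2 sqrtrM ?sqr_ge0// sqrtr_sqr gtr0_norm.
Qed.

Let randers_norm (u : 'rV[R]_n) :
  Num.sqrt (dot u u) * phi (dot u k / Num.sqrt (dot u u)) =
  Num.sqrt (phi 0 ^+ 2 * (dot u u + kk * (dot u k * dot u k))) + C2 * dot u k.
Proof.
rewrite norm'; have [->|u0] := eqVneq u 0.
  by rewrite !dot0l expr0n !mulr0 !addr0 sqrtr0 mul0r mulr0.
have r0 : 0 < Num.sqrt (dot u u) by rewrite sqrtr_gt0 dot_gt0.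
rewrite (dotC u k) -/(ab_arg k u); have [w0 ->] := phiE (ab_arg_le k u0).
rewrite (dotC k) -quadE// sqrtrM ?dot_ge0// mulrDr; congr (_ + _).
  by rewrite mulrCA.
rewrite mulrCA; congr (_ * _); rewrite /ab_arg (dotC u) mulrC divfK//.
by rewrite gt_eqF.
Qed.

Let ta'_metric : is_riemannian_metric ta'.
Proof.
have [sym lin pos smo] := ta_metric; have [blin bsmo] := beta_form.
split.
- by move=> p u v pu pv; rewrite /ta' (sym p u v)// (mulrC (beta p u)).
- move=> p a u v w pu pv pw; rewrite /ta' lin// /beta blin//.
  by move: (ta p u w) (ta p v w) (ta p u (X p)) => *; ring.
- move=> p v pv v0; have [u [vv vX uv]] := tangent_frame pv.
  rewrite /ta' /beta vv vX -expr2 mulr_gt0 ?exprn_gt0// quad_gt0//.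
  by apply: contra_notN v0 => /eqP.
- move=> c y z cc m; have oU := @cimg_open _ _ _ c.
  have sb w := bsmo c w cc.
  have cst_smooth (e : R) : Ck_on m (fun _ : 'rV[R]_n => e) (cimg c) by exact: Ck_on_cst.
  exact: (Ck_onM oU (cst_smooth (phi 0 ^+ 2)) (Ck_onD oU (smo c y z cc m)
    (Ck_onM oU (cst_smooth kk) (Ck_onM oU (sb y m) (sb z m))))).
Qed.

Let beta'_form : is_one_form (fun p v => C2 * beta p v).
Proof.
have [blin bsmo] := beta_form; split.
  by move=> p a u v pu pv; rewrite /beta blin// mulrDr mulrCA.
move=> c y cc m; apply: Ck_onM (bsmo c y cc m); first exact: cimg_open.
exact: Ck_on_cst.
Qed.

(** The ratio of C beta to the new Riemannian norm is largest in the direction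
    of X, by the Cauchy-Schwarz inequality; there it is less than one because
    both phi(|k|) and phi(-|k|) are positive. *)
Lemma is_randers_of_type : is_randers F.
Proof.
split => //; exists ta', (fun p v => C2 * beta p v); split => //; last first.
  move=> p v pv; have [u [vv vX _]] := tangent_frame pv.
  by rewrite FE// /riem_norm /ta' /beta vv vX randers_norm.
move=> p.
have bb : `|b| <= b by rewrite ger0_norm.
have nbb : `|- b| <= b by rewrite normrN ger0_norm.
have [w0 phib] := phiE bb; have [_ phiNb] := phiE nbb.
set w := Num.sqrt (1 + kk * b ^+ 2).
have w_gt0 : 0 < w by rewrite sqrtr_gt0.
have pw : 0 < phi 0 * w by rewrite mulr_gt0.
have C2b : `|C2| * b < phi 0 * w.
  have h1 := phi_gt0 bb; have h2 := phi_gt0 nbb.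
  rewrite phib -/w in h1; rewrite phiNb sqrrN -/w in h2.
  rewrite -[b in X in X < _]ger0_norm// -normrM ltr_norml.
  by apply/andP; split; lra.
apply: (@le_lt_trans _ _ (`|C2| * b / (phi 0 * w))%:E); last first.
  by rewrite lte_fin ltr_pdivrMr// mul1r.
apply: ge_ereal_sup => _ [v [pv v1] <-]; rewrite lee_fin ler_pdivlMr//.
have [u [vv vX _]] := tangent_frame pv.
have N1 : phi 0 * Num.sqrt (dot u u + kk * dot u k ^+ 2) <= 1.
  by move: v1; rewrite /riem_norm /ta' /beta vv vX norm'.
have bw : `|dot u k| * w <= b * Num.sqrt (dot u u + kk * dot u k ^+ 2).
  rewrite -sqrtr_sqr /w /b -!sqrtrM ?sqr_ge0 ?dot_ge0// ler_wsqrtr//.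
  rewrite -/b (sqr_sqrtr (dot_ge0 k)).
  by have := dot_CS u k; lra.
rewrite /beta vX normrM.
apply: (@le_trans _ _ (`|C2| * phi 0 * (`|dot u k| * w))).
  by rewrite le_eqVlt; apply/orP; left; apply/eqP; ring.
apply: (@le_trans _ _ (`|C2| * phi 0 * (b * Num.sqrt (dot u u + kk * dot u k ^+ 2)))).
  by rewrite ler_wpM2l// mulr_ge0// ltW.
rewrite mulrACA -[leRHS]mulr1 ler_wpM2l// mulr_ge0//.
Qed.

End RandersMetric.

(** * The Lie algebra l_(5,6) *)

Section RegularPhi.
Variables (R : realType) (b0 : \bar R) (phi : R -> R).
Hypothesis phi_reg : regular_phi b0 phi.

Lemma regular_phi_derive (s : R) : (`|s|%:E < b0)%E ->
  is_derive s 1 phi (derive1 phi s) /\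
  is_derive s 1 (derive1 phi) (derive1n 2 phi s) /\
  {for s, continuous (derive1n 2 phi)}.
Proof.
move=> sb; have [_ sm _ _] := phi_reg.
have D1 (f : R -> R) : (fun x : R => 'D_(1 : R) f x) = derive1 f.
  by apply/funext => x; rewrite derive1E.
have dd (f : R -> R) : differentiable f s -> is_derive s 1 f (derive1 f s).
  by move=> df; rewrite derive1E; apply: derivableP; apply: diff_derivable.
have [df /(_ 1)] := sm 2%N; rewrite D1 => -[df1 /(_ 1)]; rewrite D1 => cf2.
rewrite derive1nS derive1n1.
by split; [apply: dd; exact: df|split; [apply: dd; exact: df1|exact: cf2]].
Qed.

End RegularPhi.

Section L56.
Variables (R : realType) (a b c d f g h : R).

Definition l56_coef (i j : nat) : seq R :=
  match i, j with
  | 0, 1 => [:: 0; 0; a; b; c]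
  | 0, 2 => [:: 0; 0; 0; d; f]
  | 0, 3 => [:: 0; 0; 0; 0; g]
  | 1, 2 => [:: 0; 0; 0; 0; h]
  | _, _ => [::]
  end.

(** The table lists the brackets [E_(i+1), E_(j+1)] for i < j only;
    antisymmetrising it gives all structure constants. *)
Definition l56_const (i j : 'I_5) : 'rV[R]_5 :=
  \row_l (nth 0 (l56_coef i j) l - nth 0 (l56_coef j i) l).

Lemma l56_const_skew i j : l56_const i j = - l56_const j i.
Proof. by apply/rowP => l; rewrite !mxE opprB. Qed.

Lemma sum_ord5 (V : nmodType) (P : 'I_5 -> V) : \sum_i P i =
  P (inord 0) + P (inord 1) + P (inord 2) + P (inord 3) + P (inord 4).
Proof.
rewrite !big_ord_recl big_ord0 addr0 !addrA.
by do !congr (_ + _); congr (P _); apply/val_inj; rewrite /= inordK.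
Qed.

Lemma lie_bracket_skew n (M : manifoldType R n) (X Y : vfield R M) p u :
  lie_bracket X Y p u = - lie_bracket Y X p u.
Proof.
rewrite /lie_bracket /on_germs; case: ifP => _; last by rewrite oppr0.
by rewrite opprB.
Qed.

Lemma l56_bracket_const (G : lieGroupType R 5) (E : 'I_5 -> vfield R G) :
  l56_brackets E a b c d f g h ->
  forall i j p u, lie_bracket (E i) (E j) p u = \sum_l l56_const i j 0 l * E l p u.
Proof.
move=> Eb.
have lt_case (i j : 'I_5) : (i < j)%N -> forall p u,
    lie_bracket (E i) (E j) p u = \sum_l l56_const i j 0 l * E l p u.
  move=> ij p u; rewrite sum_ord5 !mxE !inordK//.
  have [[h12 h13 h14 h23] [[h15 h24 h25] [h34 h35 h45]]] := Eb p u.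
  rewrite -(inord_val i) -(inord_val j) !inordK//; move: ij.
  case: i => -[|[|[|[|[|i]]]]] //= _; case: j => -[|[|[|[|[|j]]]]] //= _ _;
    rewrite ?h12 ?h13 ?h14 ?h23 ?h15 ?h24 ?h25 ?h34 ?h35 ?h45 /=; ring.
move=> i j p u; have [ij|ji|/val_inj ij] := ltngtP i j; first exact: lt_case.
  rewrite lie_bracket_skew lt_case// -sumrN; apply: eq_bigr => l _.
  by rewrite !mxE; ring.
rewrite ij; have := lie_bracket_skew (E j) (E j) p u.
rewrite big1 => [e|l _]; last by rewrite mxE subrr mul0r.
lra.
Qed.

Local Notation br := (frame_bracket l56_const).
Local Notation e m := (delta_mx 0 (inord m) : 'rV[R]_5).

Lemma frame_bracket_delta n (C : 'I_n -> 'I_n -> 'rV[R]_n) i j :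
  frame_bracket C (delta_mx 0 i) (delta_mx 0 j) = C i j.
Proof.
rewrite /frame_bracket (bigD1 i)//= [X in _ + X]big1 ?addr0 => [|i' ii'].
  rewrite (bigD1 j)//= [X in _ + X]big1 ?addr0 => [|j' jj'].
    by rewrite !mxE !eqxx mulr1 scale1r.
  by rewrite !mxE (negPf jj') andbF mulr0 scale0r.
by rewrite big1// => j' _; rewrite !mxE (negPf ii') andbF mul0r scale0r.
Qed.

Hypotheses (a_gt0 : 0 < a) (d_gt0 : 0 < d) (g_gt0 : 0 < g).

(** If k is orthogonal to [E_1, E_4], [E_1, E_3] and [E_1, E_2], its last three
    components vanish in turn.  Then for z = - k_2 E_1 + k_1 E_2 + E_3 the
    product <z, [k, z]> only sees the E_3 component of (k_1^2 + k_2^2) [E_1, E_2],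
    which is a (k_1^2 + k_2^2). *)
Lemma l56_closed_witness (k : 'rV[R]_5) : k != 0 ->
  (forall w y, dot k (br w y) = 0) ->
  exists z, dot k z = 0 /\ dot z (br k z) != 0.
Proof.
move=> k0 closed.
have kC (i j : 'I_5) : dot k (l56_const i j) = 0.
  by rewrite -frame_bracket_delta closed.
pose x m := k 0 (inord m).
have k4 : x 4 = 0.
  have := kC (inord 0) (inord 3); rewrite /dot sum_ord5 !mxE !inordK//= => H.
  by apply: (mulIf (lt0r_neq0 g_gt0)); rewrite mul0r -[RHS]H /x; ring.
have k3 : x 3 = 0.
  have := kC (inord 0) (inord 2); rewrite /dot sum_ord5 !mxE !inordK//= => H.
  apply: (mulIf (lt0r_neq0 d_gt0)); rewrite mul0r -[RHS]H -/(x 4) k4 /x; ring.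
have k2 : x 2 = 0.
  have := kC (inord 0) (inord 1); rewrite /dot sum_ord5 !mxE !inordK//= => H.
  apply: (mulIf (lt0r_neq0 a_gt0)); rewrite mul0r -[RHS]H -/(x 3) -/(x 4) k3 k4 /x; ring.
have kE : k = x 0 *: e 0 + x 1 *: e 1.
  by rewrite {1}(row_sum_delta k) sum_ord5 -!/(x _) k2 k3 k4 !scale0r !addr0.
have k01 : 0 < x 0%N ^+ 2 + x 1%N ^+ 2.
  rewrite lt_neqAle addr_ge0 ?sqr_ge0// andbT eq_sym; apply: contraNneq k0 => /eqP.
  rewrite paddr_eq0 ?sqr_ge0// !sqrf_eq0 => /andP[/eqP x0 /eqP x1].
  by rewrite kE x0 x1 !scale0r addr0.
pose z : 'rV[R]_5 := - x 1%N *: e 0 + (x 0%N *: e 1 + e 2).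
have dotk v : dot k v = x 0%N * v 0 (inord 0) + x 1%N * v 0 (inord 1).
  by rewrite /dot sum_ord5 -!/(x _) k2 k3 k4 !mul0r !addr0.
have eE i j : (i < 5)%N -> (j < 5)%N -> e i 0 (inord j) = (j == i)%:R.
  move=> i5 j5; rewrite mxE eqxx /=.
  have -> : (inord j == inord i :> 'I_5) = (j == i) by rewrite -val_eqE /= !inordK.
  by [].
have zE j : (j < 5)%N -> z 0 (inord j) = - x 1%N * (j == 0%N)%:R + (x 0%N * (j == 1%N)%:R + (j == 2%N)%:R).
  move=> j5; rewrite -(eE 0%N)// -(eE 1%N)// -(eE 2%N)//.
  by rewrite 5!mxE; ring.
exists z; split.
  by rewrite dotk !zE//=; ring.
have brk w : br k w = x 0%N *: br (e 0) w + x 1%N *: br (e 1) w.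
  rewrite {1}kE frame_bracket_linl; congr (_ + _).
  have br0 : br 0 w = 0.
    by rewrite /frame_bracket big1// => i _; rewrite big1// => j _; rewrite mxE mul0r scale0r.
  by rewrite -[x 1%N *: e 1]addr0 frame_bracket_linl br0 addr0.
have brz v : br v z = - x 1%N *: br v (e 0) + (x 0%N *: br v (e 1) + br v (e 2)).
  by rewrite /z !frame_bracket_linr.
rewrite brk !brz !frame_bracket_delta /dot sum_ord5 !zE//= !mxE !inordK//=.
have nz : a * (x 0%N ^+ 2 + x 1%N ^+ 2) != 0 by rewrite mulf_neq0// lt0r_neq0.
by apply: contraNneq nz => <-; apply/eqP; ring.
Qed.

End L56.

(** * The theorem *)

Theorem theorem3p6 (R : realType) (G : lieGroupType R 5)
    (ta : G -> tvec R G -> tvec R G -> R) (E : 'I_5 -> vfield R G)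
    (a b c d f g h : R)
    (G_simply_connected : simply_connected R G)
    (G_nilpotent : nilpotent_group G)
    (ta_left_invariant : left_invariant_metric ta)
    (E_basis : lie_algebra_basis E)
    (E_orthonormal : orthonormal_frame ta E)
    (E_brackets : l56_brackets E a b c d f g h)
    (a_gt0 : 0 < a) (d_gt0 : 0 < d) (g_gt0 : 0 < g) (h_gt0 : 0 < h)
    (bf_cond : 0 < b \/ (b = 0 /\ 0 <= f)) :
  forall (F : G -> tvec R G -> R) (X : vfield R G),
    left_invariant_vfield X ->
    is_alpha_beta_metric ta (fun p y => ta p y (X p)) F ->
    left_invariant_finsler F ->
    ~ is_riemannian F ->
    douglas_type F ->
    is_randers F.
Proof.
move=> F X X_li [F_finsler _ beta_form [b0 [phi [phi_reg beta_lt FE]]]] _ _ F_douglas.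
have [ta_metric _] := ta_left_invariant.
have [E_li /(_ X X_li) [k [XE _]]] := E_basis.
have E_vfield i : is_vfield (E i) := (E_li i).1.
have E_bracket := l56_bracket_const E_brackets.
pose rho : R := Num.sqrt (dot k k).
have rho_lt : (rho%:E < b0)%E.
  apply: le_lt_trans (beta_lt 1%g).
  exact: one_form_norm_ge ta_metric E_orthonormal E_vfield XE _.
have in_dom (s : R) : `|s| <= rho -> (`|s|%:E < b0)%E.
  by move=> sb; apply: le_lt_trans rho_lt; rewrite lee_fin.
have [_ _ phi_pos phi_conv] := phi_reg.
have dphi (s : R) : `|s| <= rho -> is_derive s 1 phi (derive1 phi s).
  by move=> /in_dom/(regular_phi_derive phi_reg)[].
have dphi1 (s : R) : `|s| <= rho -> is_derive s 1 (derive1 phi) (derive1n 2 phi s).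
  by move=> /in_dom/(regular_phi_derive phi_reg)[_ []].
have phi2_cont (s : R) : `|s| <= rho -> {for s, continuous (derive1n 2 phi)}.
  by move=> /in_dom/(regular_phi_derive phi_reg)[_ []].
have phi_gt0 (s : R) : `|s| <= rho -> 0 < phi s by move=> /in_dom/phi_pos.
have D_gt0 (s : R) : `|s| <= rho ->
    0 < phi s - s * derive1 phi s + (rho ^+ 2 - s ^+ 2) * derive1n 2 phi s.
  by move=> sb; exact: phi_conv.
have u_gt0 (s : R) : `|s| <= rho -> 0 < phi s - s * derive1 phi s.
  move=> /in_dom sb; have := phi_conv s `|s| (lexx _) sb.
  by rewrite real_normK ?num_real// subrr mul0r addr0.
suff [kk [C2 phiE]] : exists kk C2, forall s : R, `|s| <= rho ->
    0 < 1 + kk * s ^+ 2 /\ phi s = phi 0 * Num.sqrt (1 + kk * s ^+ 2) + C2 * s.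
  exact: (is_randers_of_type ta_metric E_orthonormal E_vfield XE beta_form
            F_finsler FE phi_gt0 phiE).
have [k0|k0] := eqVneq k 0.
  exists 0, 0 => s; rewrite /rho k0 dot0l sqrtr0 normr_le0 => /eqP ->.
  by rewrite !mul0r !addr0 sqrtr1 mulr1.
have [ch ch_atlas ch1] := atlas_cover (1%g : G).
have cch := atlas_coord_chart ch_atlas.
have [xi [sxi Exi]] := frame_in_chart E_vfield cch.
have [Q [Q_quad Q_eq]] := douglas_frame ta_metric E_orthonormal cch sxi Exi
  (cfun_img ch1) E_bracket dphi dphi1 phi_gt0 XE FE F_finsler F_douglas
  (l56_const_skew a b c d f g h).
apply: (randers_type_of_douglas (frame_bracket_linl _) (frame_bracket_linr _)
  (fun u => frame_bracket_alt u (l56_const_skew a b c d f g h))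
  Q_quad Q_eq k0 u_gt0 D_gt0 dphi dphi1 phi2_cont phi_gt0) => //.
exact: (@l56_closed_witness R a b c d f g h a_gt0 d_gt0 g_gt0 k k0).
Qed.
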